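(* Let $k\ge1$ be an integer and $f\in F_{k,0}$. Then $\widetilde f\in F_{0,0}\otimes V_{2k-2}$ (i.e. each coefficient of $\widetilde f$ is annihilated by $\Delta$), and \[ f=(\widetilde f,Q_z^{k-1}),\qquad \delta^lf=(\widetilde f,\delta^lQ_z^{k-1})\ (1-k\le l\le k-1), \] \[ \frac{\partial\widetilde f}{\partial z}=(X-z)^{2k-2}\frac{(-1)^{k-1}\delta^kf}{(k-1)!},\qquad \frac{\partial\widetilde f}{\partial\bar z}=(X-\bar z)^{2k-2}\frac{\bar\delta^kf}{(k-1)!}. \] Conversely, if $g\in F_{0,0}\otimes V_{2k-2}$ is such that $\partial g/\partial z$ is divisible by $(X-z)^{2k-2}$ and $\partial g/\partial\bar z$ is divisible by $(X-\bar z)^{2k-2}$ (as polynomials in $X$), then $f(z):=(g(z),Q_z^{k-1})$ lies in $F_{k,0}$ and $g=\widetilde f$.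
   Context: Functions are smooth complex functions on $\mathfrak H\setminus S$ for a discrete $S\subset\mathfrak H$, with an attached weight $w\in\mathbb Z$. Operators: $\delta f=\frac{\partial f}{\partial z}+\frac w{z-\bar z}f$ (weight $w+2$), $\delta^-f=(z-\bar z)^2\frac{\partial f}{\partial\bar z}$ (weight $w-2$), $\Delta_wf=(z-\bar z)^2\frac{\partial^2f}{\partial z\partial\bar z}+w(z-\bar z)\frac{\partial f}{\partial\bar z}$. $F_{k,w}$ is the space of weight-$w$ functions with $\Delta_wf=(k(1-k)+\frac{w(w-2)}4)f$. On $F_{k,w+2}$ with $w\notin\{2k-2,-2k\}$, $\delta^{-1}:=\frac4{(w+2k)(w-2k+2)}\delta^-$ (mapping to $F_{k,w}$); negative powers $\delta^l$, $l<0$, are iterates of this. Operators act coefficientwise on polynomial-valued functions. $\bar\delta g:=\overline{\delta\bar g}$, so $\bar\delta^kf=\overline{\delta^k\bar f}$. $V_{2k-2}$ is the space of polynomials in $X$ of degree $\le2k-2$ with pairing $(\sum p_iX^i,\sum q_iX^i)=\sum_i(-1)^ip_iq_{2k-2-i}/\binom{2k-2}i$. $Q_z=\frac{(X-z)(X-\bar z)}{z-\bar z}$ (weight $0$ in $z$). For $f\in F_{k,0}$, \[ \widetilde f=(-1)^{k-1}\frac{(2k-2)!}{(k-1)!}\sum_{l=1-k}^{k-1}\frac{(X-z)^{k+l-1}}{(k+l-1)!}\Big(\frac{X-\bar z}{z-\bar z}\Big)^{k-l-1}\delta^lf. \] *)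

(* Defs.v *)
(* MathComp / MathComp-Analysis, over an arbitrary R : realType. *)
From HB Require Import structures.
From mathcomp Require Import all_boot all_order all_algebra.
From mathcomp Require Import all_classical all_reals all_analysis.
From mathcomp Require Export complex.

Set Implicit Arguments.
Unset Strict Implicit.
Unset Printing Implicit Defensive.

Import Order.TTheory GRing.Theory Num.Theory.
Import numFieldNormedType.Exports.

Local Open Scope classical_set_scope.
Local Open Scope ring_scope.

(* [Rcomplex R] is the complex field R[i] seen as a vector space over R, normed
   by the complex modulus.  With the instances below it is a normed R-module, so
   that ['D_v f z] is a derivative along the REAL line z + t v. *)
HB.instance Definition _ (R : realType) :=
  PseudoMetric.copy (Rcomplex R) (pseudoMetric_normed (Rcomplex R)).
HB.instance Definition _ (R : realType) := isPointed.Build (Rcomplex R) 0.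
HB.instance Definition _ (R : realType) :=
  NormedZmod_PseudoMetric_eq.Build R (Rcomplex R) erefl.

Lemma Rcomplex_normrZ (R : realType) (l : R) (x : Rcomplex R) :
  `|l *: x| = `|l| * `|x|.
Proof.
case: x => a b; rewrite /Num.norm /= !exprMn -mulrDr sqrtrM ?sqr_ge0//.
by rewrite sqrtr_sqr.
Qed.

HB.instance Definition _ (R : realType) :=
  PseudoMetricNormedZmod_Lmodule_isNormedModule.Build R (Rcomplex R)
    (@Rcomplex_normrZ R).

Definition imagunit {R : realType} : Rcomplex R := Complex 0 1.

Definition cconj {R : realType} (z : Rcomplex R) : Rcomplex R := conjc z.

Definition upper_half_plane (R : realType) : set (Rcomplex R) :=
  [set z | 0 < complex.Im z].

(* Discreteness is relative to the half-plane: no accumulation point inside it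
   (so that the complement of [S] in it is open); accumulation at the real line
   is allowed. *)
Definition discrete_in_half_plane (R : realType) (S : set (Rcomplex R)) : Prop :=
  S `<=` @upper_half_plane R /\
  limit_point S `&` @upper_half_plane R = set0.

(* A function on the half-plane minus [S] is represented by a total function on
   the complex numbers, of which only the values on [domain S] matter. *)
Definition domain (R : realType) (S : set (Rcomplex R)) : set (Rcomplex R) :=
  @upper_half_plane R `\` S.

Fixpoint Cn_on (R : realType) (n : nat) (U : set (Rcomplex R))
    (f : Rcomplex R -> Rcomplex R) : Prop :=
  if n is m.+1 then
    [/\ forall z, U z -> derivable f z 1 /\ derivable f z imagunit,
        Cn_on m U ('D_1 f) & Cn_on m U ('D_imagunit f)]
  else forall z, U z -> {for z, continuous f}.

Definition smooth_on (R : realType) (U : set (Rcomplex R))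
    (f : Rcomplex R -> Rcomplex R) : Prop := forall n, Cn_on n U f.

Definition dz (R : realType) (f : Rcomplex R -> Rcomplex R) (z : Rcomplex R) :
    Rcomplex R :=
  2^-1 * ('D_1 f z - imagunit * 'D_imagunit f z).

Definition dzbar (R : realType) (f : Rcomplex R -> Rcomplex R)
    (z : Rcomplex R) : Rcomplex R :=
  2^-1 * ('D_1 f z + imagunit * 'D_imagunit f z).

(* The weight of a function is not stored with it: the operators below take as
   argument [w] the weight of the function which they are applied to, except
   [delta_inv]. *)
Definition delta (R : realType) (w : int) (f : Rcomplex R -> Rcomplex R)
    (z : Rcomplex R) : Rcomplex R :=
  dz f z + w%:~R / (z - cconj z) * f z.

Definition delta_minus (R : realType) (f : Rcomplex R -> Rcomplex R)
    (z : Rcomplex R) : Rcomplex R :=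
  (z - cconj z) ^+ 2 * dzbar f z.

Definition Laplace (R : realType) (w : int) (f : Rcomplex R -> Rcomplex R)
    (z : Rcomplex R) : Rcomplex R :=
  (z - cconj z) ^+ 2 * dz (dzbar f) z + w%:~R * (z - cconj z) * dzbar f z.

Definition F (R : realType) (k w : int) (S : set (Rcomplex R))
    (f : Rcomplex R -> Rcomplex R) : Prop :=
  smooth_on (domain S) f /\
  forall z, domain S z ->
    Laplace w f z = ((k * (1 - k))%:~R + (w * (w - 2))%:~R / 4) * f z.

(* Maps weight [w + 2] to weight [w]; meant for w different from 2k-2 and -2k. *)
Definition delta_inv (R : realType) (k w : int) (f : Rcomplex R -> Rcomplex R)
    (z : Rcomplex R) : Rcomplex R :=
  4 / ((w + 2 * k) * (w - 2 * k + 2))%:~R * delta_minus f z.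

(* n-fold iterates, starting from weight [w]. *)
Fixpoint delta_iter (R : realType) (w : int) (n : nat)
    (f : Rcomplex R -> Rcomplex R) : Rcomplex R -> Rcomplex R :=
  if n is m.+1 then delta (w + 2 * m%:Z) (delta_iter w m f) else f.

Fixpoint delta_inv_iter (R : realType) (k w : int) (n : nat)
    (f : Rcomplex R -> Rcomplex R) : Rcomplex R -> Rcomplex R :=
  if n is m.+1 then delta_inv k (w - 2 * m.+1%:Z) (delta_inv_iter k w m f)
  else f.

Definition delta_pow (R : realType) (k w l : int)
    (f : Rcomplex R -> Rcomplex R) : Rcomplex R -> Rcomplex R :=
  match l with
  | Posz n => delta_iter w n f
  | Negz n => delta_inv_iter k w n.+1 f
  end.

(* Here [w] is the weight of the conjugate of [f]. *)
Definition deltabar_iter (R : realType) (w : int) (n : nat)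
    (f : Rcomplex R -> Rcomplex R) (z : Rcomplex R) : Rcomplex R :=
  cconj (delta_iter w n (fun u => cconj (f u)) z).

(* [V n] consists of the polynomials [p] with [size p <= n.+1]; an operator acts
   on functions with values in [V n] through the coefficients 0, ..., n. *)
Definition coefwise (R : realType) (n : nat)
    (T : (Rcomplex R -> Rcomplex R) -> Rcomplex R -> Rcomplex R)
    (g : Rcomplex R -> {poly Rcomplex R}) (z : Rcomplex R) :
    {poly Rcomplex R} :=
  \poly_(i < n.+1) T (fun u => (g u)`_i) z.

Definition F_tensor_V (R : realType) (k w : int) (n : nat)
    (S : set (Rcomplex R)) (g : Rcomplex R -> {poly Rcomplex R}) : Prop :=
  (forall z, domain S z -> (size (g z) <= n.+1)%N) /\
  forall i, (i <= n)%N -> F k w S (fun z => (g z)`_i).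

Definition pairing (R : realType) (n : nat) (p q : {poly Rcomplex R}) :
    Rcomplex R :=
  \sum_(i < n.+1) (-1) ^+ i * p`_i * q`_(n - i) / 'C(n, i)%:R.

Definition Q (R : realType) (z : Rcomplex R) : {poly Rcomplex R} :=
  (z - cconj z)^-1 *: (('X - z%:P) * ('X - (cconj z)%:P)).

(* The summation index is m = k + l - 1, so that l = m - (k - 1) and
   k - l - 1 = (2k - 2) - m. *)
Definition tilde (R : realType) (k : nat) (f : Rcomplex R -> Rcomplex R)
    (z : Rcomplex R) : {poly Rcomplex R} :=
  ((-1) ^+ (k - 1) * ((2 * k - 2)`!)%:R / ((k - 1)`!)%:R) *:
    \sum_(m < (2 * k - 2).+1)
      delta_pow k%:Z 0 (m%:Z - (k%:Z - 1)) f z *: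
      ((m`!)%:R^-1 *: ('X - z%:P) ^+ m *
       ((z - cconj z)^-1 *: ('X - (cconj z)%:P)) ^+ (2 * k - 2 - m)).

(* Main.v *)
Require Import Defs.
From mathcomp Require Import all_boot all_order all_algebra.
From mathcomp Require Import all_classical all_reals all_analysis.
From mathcomp Require Import ring zify.

Set Implicit Arguments.
Unset Strict Implicit.
Unset Printing Implicit Defensive.

Import Order.TTheory GRing.Theory Num.Theory.
Import numFieldNormedType.Exports.

Local Open Scope classical_set_scope.
Local Open Scope ring_scope.

(** Write n = 2k - 2, N = k - 1, y = 1 / (z - zbar) and
    e_m = (X - z)^m / m! * (y (X - zbar))^(n - m).  Then
      delta_(n - 2m) e_m = - e_(m-1),  delta^- e_m = (n - m)(m + 1) e_(m+1),
    while T_m = delta^(m - N) f satisfies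
      delta T_m = T_(m+1),  delta^- T_(m+1) = - (m + 1)(n - m) T_m
    (this uses the symmetry of second derivatives).  Hence both Wirtinger
    derivatives of sum_m T_m e_m telescope to a single term.  The e_m are
    self-dual up to sign for the pairing, which gives the pairings of the tilde
    of f with delta^l Q^N = (-1)^l N! e_(N - l).  Conversely, since (X - a)^n
    represents evaluation at a, and e_m vanishes at z for m > 0 and at zbar for
    m < n, the divisibility hypotheses imply that the functions (g, delta^l Q^N)
    are related by delta and delta^- in the same way as the T_m.  So g and the
    tilde of f = (g, Q^N) have the same pairings with all the e_m, and they are equal. *)

(** * Derivatives of functions of a complex variable along real lines *)

Section Complex.
Context {R : realType}.
Local Notation C := (Rcomplex R).
Implicit Types (z v : C) (f g : C -> C).

Lemma natrC_eq0 (n : nat) : ((n%:R : C) == 0) = (n == 0)%N.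
Proof. exact: (@pnatr_eq0 R[i] n). Qed.

Lemma ReZ1 (x : R) : x *: (1 : C) = Complex x 0.
Proof. by rewrite /GRing.scale /= mulr1 mulr0. Qed.

Lemma ReZi (x : R) : x *: (imagunit : C) = Complex 0 x.
Proof. by rewrite /imagunit /GRing.scale /= mulr1 mulr0. Qed.

Lemma complexZE z : z = complex.Re z *: 1 + complex.Im z *: imagunit.
Proof. rewrite ReZ1 ReZi; case: z => a b. rewrite /GRing.add /= addr0 add0r. by []. Qed.

Lemma ReB z v : complex.Re (z - v) = complex.Re z - complex.Re v.
Proof. by case: z v => [? ?] [? ?]. Qed.

Lemma ImB z v : complex.Im (z - v) = complex.Im z - complex.Im v.
Proof. by case: z v => [? ?] [? ?]. Qed.

Lemma norm_Re z : `|complex.Re z| <= `|z|.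
Proof.
case: z => a b; rewrite [in leRHS]/Num.norm /= -sqrtr_sqr ler_wsqrtr//.
by rewrite lerDl sqr_ge0.
Qed.

Lemma norm_Im z : `|complex.Im z| <= `|z|.
Proof.
case: z => a b; rewrite [in leRHS]/Num.norm /= -sqrtr_sqr ler_wsqrtr//.
by rewrite lerDr sqr_ge0.
Qed.

Lemma continuous_Re : continuous (@complex.Re R : C -> R).
Proof.
move=> z; have F : Filter (nbhs (z : C)) by exact: nbhs_filter.
apply/cvgrPdist_le => e e0; near=> t.
rewrite -ReB.
apply: le_trans (norm_Re _) _; near: t.
by apply: (@cvgr_dist_le _ C _ _ _ id z cvg_id).
Unshelve. all: by end_near. Qed.

Lemma continuous_Im : continuous (@complex.Im R : C -> R).
Proof.
move=> z; have F : Filter (nbhs (z : C)) by exact: nbhs_filter.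
apply/cvgrPdist_le => e e0; near=> t.
rewrite -ImB.
apply: le_trans (norm_Im _) _; near: t.
by apply: (@cvgr_dist_le _ C _ _ _ id z cvg_id).
Unshelve. all: by end_near. Qed.

Lemma cvg_mulC {T : Type} {G : set_system T} {FG : Filter G}
    (f g : T -> C) (a b : C) :
  f @ G --> a -> g @ G --> b -> (fun t => f t * g t) @ G --> a * b.
Proof.
move=> fa gb.
have reE u v : complex.Re (u * v : C) =
  complex.Re u * complex.Re v - complex.Im u * complex.Im v by case: u v => [? ?] [? ?].
have imE u v : complex.Im (u * v : C) =
  complex.Re u * complex.Im v + complex.Im u * complex.Re v by case: u v => [? ?] [? ?].
have rf := cvg_comp f _ fa (@continuous_Re a).
have imf := cvg_comp f _ fa (@continuous_Im a).
have rg := cvg_comp g _ gb (@continuous_Re b).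
have img := cvg_comp g _ gb (@continuous_Im b).
rewrite (complexZE (a * b)).
under eq_fun do rewrite (complexZE (_ * _)) !reE !imE.
rewrite reE imE; apply: cvgD; apply: cvgZr_tmp.
- by apply: cvgB; apply: cvgM.
- by apply: cvgD; apply: cvgM.
Qed.

Lemma scaleCr (x : R) z v : x *: (z * v) = z * (x *: v) :> C.
Proof. by rewrite mulrC scalerAl mulrC. Qed.

Lemma is_deriveMC f g z v (df dg : C) :
  is_derive z v f df -> is_derive z v g dg ->
  is_derive z v (fun u => f u * g u) (df * g z + f z * dg).
Proof.
move=> [fv <-] [gv <-].
have gc : (fun h : R => g (h *: v + z)) @ 0^' --> g z.
  suff : {for 0, continuous (fun h : R => g (h *: v + z))}.
    by move=> /continuous_withinNx; rewrite scale0r add0r.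
  exact/differentiable_continuous/derivable1_diffP/(derivable1P _ _ _).1.
have : (fun h => h^-1 *: (((fun u => f u * g u) \o shift z) (h *: v) - f z * g z)) @ 0^'
    --> 'D_v f z * g z + f z * 'D_v g z.
  have -> : (fun h => h^-1 *: (((fun u => f u * g u) \o shift z) (h *: v) - f z * g z)) =
    (fun h => h^-1 *: ((f \o shift z) (h *: v) - f z) * g (h *: v + z) +
              f z * (h^-1 *: ((g \o shift z) (h *: v) - g z))).
    apply/funext => h /=; rewrite -scalerAl -scaleCr -scalerDr; congr (_ *: _).
    ring.
  apply: cvgD; apply: cvg_mulC => //; exact: cvg_cst.
move=> H; split; first by apply/cvg_ex; eexists; exact: H.
exact: cvg_lim H.
Qed.

Lemma is_derive_ReF f z v df : is_derive z v f df ->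
  is_derive z v (fun u => complex.Re (f u)) (complex.Re df).
Proof.
move=> [fv <-].
have E : (fun h : R => complex.Re (h^-1 *: (f (h *: v + z) - f z))) =
  (fun h => h^-1 *: (((fun u => complex.Re (f u)) \o shift z) (h *: v) - complex.Re (f z))).
  by apply/funext => h /=; rewrite -ReB; case: (f _ - _).
have H : (fun h => h^-1 *: (((fun u => complex.Re (f u)) \o shift z) (h *: v) - complex.Re (f z))) @ 0^'
    --> complex.Re ('D_v f z).
  rewrite -E; exact: cvg_comp fv (@continuous_Re ('D_v f z)).
split; first by apply/cvg_ex; eexists; exact: H.
exact: cvg_lim H.
Qed.

Lemma is_derive_ImF f z v df : is_derive z v f df ->
  is_derive z v (fun u => complex.Im (f u)) (complex.Im df).
Proof.
move=> [fv <-].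
have E : (fun h : R => complex.Im (h^-1 *: (f (h *: v + z) - f z))) =
  (fun h => h^-1 *: (((fun u => complex.Im (f u)) \o shift z) (h *: v) - complex.Im (f z))).
  by apply/funext => h /=; rewrite -ImB; case: (f _ - _).
have H : (fun h => h^-1 *: (((fun u => complex.Im (f u)) \o shift z) (h *: v) - complex.Im (f z))) @ 0^'
    --> complex.Im ('D_v f z).
  rewrite -E; exact: cvg_comp fv (@continuous_Im ('D_v f z)).
split; first by apply/cvg_ex; eexists; exact: H.
exact: cvg_lim H.
Qed.

Definition yinv (z : C) : C := (z - cconj z)^-1.

Lemma subconjE z : z - cconj z = (2 * complex.Im z) *: imagunit.
Proof.
case: z => a b; rewrite ReZi; transitivity (Complex (a - a) (b - - b) : C) => //.
by rewrite /= subrr opprK; congr Complex; ring.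
Qed.


Lemma is_deriveZlC (r : C -> R) (c : C) z v dr : is_derive z v r dr ->
  is_derive z v (fun u => r u *: c) (dr *: c).
Proof.
move=> [rv <-].
have E : (fun h : R => (h^-1 *: (r (h *: v + z) - r z)) *: c) =
  (fun h => h^-1 *: (((fun u => r u *: c) \o shift z) (h *: v) - r z *: c)).
  by apply/funext => h /=; rewrite -scalerBl scalerA.
have H : (fun h => h^-1 *: (((fun u => r u *: c) \o shift z) (h *: v) - r z *: c)) @ 0^'
    --> 'D_v r z *: c.
  by rewrite -E; apply: cvgZr_tmp.
split; first by apply/cvg_ex; eexists; exact: H.
exact: cvg_lim H.
Qed.

Lemma conjCE z : cconj z = complex.Re z *: 1 + (- complex.Im z) *: imagunit.
Proof. by rewrite ReZ1 ReZi; case: z => a b; rewrite /GRing.add /= addr0 add0r. Qed.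

Lemma is_derive_conjF f z v df : is_derive z v f df ->
  is_derive z v (fun u => cconj (f u)) (cconj df).
Proof.
move=> fv; rewrite conjCE; under eq_fun do rewrite conjCE.
have h1 := is_deriveZlC 1 (is_derive_ReF fv).
have h2 := is_deriveZlC imagunit (is_deriveN (is_derive_ImF fv)).
exact: is_deriveD h1 h2.
Qed.

Lemma continuous_conjF f z : {for z, continuous f} ->
  {for z, continuous (fun u => cconj (f u))}.
Proof.
move=> fz; rewrite /prop_for /continuous_at conjCE.
have F : Filter (nbhs (z : C)) by exact: nbhs_filter.
under eq_fun do rewrite conjCE.
have h1 : complex.Re (f u) @[u --> z] --> complex.Re (f z).
  exact: cvg_comp fz (@continuous_Re (f z)).
have h2 : complex.Im (f u) @[u --> z] --> complex.Im (f z).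
  exact: cvg_comp fz (@continuous_Im (f z)).
by apply: cvgD; apply: cvgZr_tmp => //; apply: cvgN.
Qed.

Lemma imagunit2 : imagunit * imagunit = -1 :> C.
Proof.
transitivity (Complex (0 * 0 - 1 * 1) (0 * 1 + 1 * 0) : C) => //.
transitivity (Complex (- 1) (- 0) : C) => //.
by rewrite !mul0r !mul1r sub0r add0r oppr0.
Qed.

Lemma imagunit_neq0 : (imagunit : C) != 0.
Proof.
apply/eqP => i0; have := imagunit2; rewrite i0 mul0r => /eqP.
by rewrite eq_sym oppr_eq0 oner_eq0.
Qed.

Lemma yinvE z : yinv z = (complex.Im z)^-1 *: (2 * imagunit)^-1.
Proof.
rewrite /yinv subconjE; have [->|z0] := eqVneq (complex.Im z) 0.
  by rewrite mulr0 invr0 !scale0r invr0.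
have i2 : (2 * imagunit : C) != 0 by rewrite mulf_neq0 ?imagunit_neq0 ?natrC_eq0.
rewrite mulrC -scalerA; have -> : (2 : R) *: (imagunit : C) = 2 * imagunit.
  by rewrite scaler_nat mulr_natl.
apply: (mulfI (x := complex.Im z *: (2 * imagunit : C))).
  by rewrite scaler_eq0 negb_or z0.
rewrite mulfV; last by rewrite scaler_eq0 negb_or z0.
by rewrite -scalerAl -scaleCr scalerA mulfV// scale1r mulfV.
Qed.

Lemma is_derive_yinv z v : complex.Im z != 0 ->
  is_derive z v yinv (- (v - cconj v) * yinv z ^+ 2).
Proof.
move=> z0.
pose d : C := (2 * imagunit)^-1.
have d0 : d != 0 by rewrite invr_neq0// mulf_neq0 ?imagunit_neq0 ?natrC_eq0.
have -> : - (v - cconj v) * yinv z ^+ 2 = (- (complex.Im z) ^- 2 * complex.Im v) *: d.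
  have -> : v - cconj v = complex.Im v *: d^-1.
    rewrite subconjE mulrC -scalerA /d invrK; congr (_ *: _).
    by rewrite scaler_nat mulr_natl.
  rewrite yinvE -/d -scaleNr expr2 -!scalerAl -!scaleCr !scalerA mulrA mulVf// mul1r.
  by congr (_ *: _); rewrite -exprVn; ring.
have -> : yinv = fun u => (complex.Im u)^-1 *: (2 * imagunit)^-1.
  by apply/funext => u; rewrite yinvE.
apply: is_deriveZlC.
have [D1 D2] := is_derive_ImF (is_derive_id z v).
split; first exact: derivableV.
by rewrite deriveV// D2.
Qed.

Lemma yinv_neq0 z : complex.Im z != 0 -> yinv z != 0.
Proof.
move=> z0; rewrite yinvE scaler_eq0 negb_or invr_eq0 z0 invr_eq0.
by rewrite mulf_neq0 ?imagunit_neq0 ?natrC_eq0.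
Qed.

Lemma subconjV z : z - cconj z = (yinv z)^-1.
Proof. by rewrite /yinv invrK. Qed.

End Complex.

Section Schwarz.
Context {R : realType} {V : normedModType R}.
Implicit Types (phi psi chi : V -> R) (z v w : V).

Lemma is_derive_line phi (gamma : R -> V) (p v : V) (c a : R) :
  (forall h, gamma (h + c) = h *: v + p) ->
  is_derive p v phi a -> is_derive c 1 (phi \o gamma) a.
Proof.
move=> gE [pv <-].
have g0 : gamma c = p by have := gE 0; rewrite add0r scale0r add0r.
have E : (fun h : R => h^-1 *: (((phi \o gamma) \o shift c) (h *: (1 : R^o)) - (phi \o gamma) c)) =
  (fun h => h^-1 *: ((phi \o shift p) (h *: v) - phi p)).
  apply/funext => h /=; rewrite g0 -gE; congr (_ *: (phi (gamma (_ + c)) - _)).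
  exact: mulr1.
by split; rewrite /derivable /derive E.
Qed.

Lemma rectangle_MVT phi psi chi z v w (s : R) : 0 < s ->
  (forall c d : R, 0 <= c <= s -> 0 <= d <= s ->
     is_derive (z + c *: v + d *: w) v phi (psi (z + c *: v + d *: w)) /\
     is_derive (z + c *: v + d *: w) w psi (chi (z + c *: v + d *: w))) ->
  exists c d : R, [/\ 0 <= c <= s, 0 <= d <= s &
    phi (z + s *: v + s *: w) - phi (z + s *: v) - phi (z + s *: w) + phi z =
    s ^+ 2 * chi (z + c *: v + d *: w)].
Proof.
move=> s0 H.
pose row d x := z + x *: v + d *: w.
have dphi d x : 0 <= x <= s -> 0 <= d <= s ->
    is_derive x 1 (phi \o row d) (psi (row d x)).
  move=> xs ds; apply: (@is_derive_line _ _ (row d x) v); last by case: (H x d xs ds).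
  by move=> h; rewrite /row scalerDl addrA (addrC z) -!addrA.
have s00 : 0 <= (0:R) <= s by rewrite lexx ltW.
have s01 : 0 <= s <= s by rewrite lexx ltW.
have [c cs Ec] : exists2 c, c \in `[0, s]%R &
    ((phi \o row s) \- (phi \o row 0)) s - ((phi \o row s) \- (phi \o row 0)) 0 =
    (psi (row s c) - psi (row 0 c)) * (s - 0).
  apply: (@MVT_segment _ _ (fun x => psi (row s x) - psi (row 0 x))) => //.
  - exact: ltW.
  - move=> x xs; have xs' : 0 <= x <= s.
      by move: xs; rewrite in_itv /= => /andP[? ?]; rewrite !ltW.
    by apply: is_deriveB; apply: dphi.
  - apply: derivable_within_continuous => x; rewrite in_itv /= => xs.
    by apply: derivableB; apply: (@ex_derive _ _ _ _ _ _ _ (dphi _ _ xs _)).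
rewrite in_itv /= in cs.
have [d ds Ed] : exists2 d, d \in `[0, s]%R &
    (psi \o (row^~ c)) s - (psi \o (row^~ c)) 0 = chi (row d c) * (s - 0).
  have D x : 0 <= x <= s -> is_derive x 1 (psi \o (row^~ c)) (chi (row x c)).
    move=> xs; apply: (@is_derive_line _ _ (row x c) w); last by case: (H c x cs xs).
    by move=> h; rewrite /row scalerDl addrCA.
  apply: (@MVT_segment _ _ (fun x => chi (row x c))) => //.
  - exact: ltW.
  - move=> x xs; apply: D.
    by move: xs; rewrite in_itv /= => /andP[? ?]; rewrite !ltW.
  - apply: derivable_within_continuous => x; rewrite in_itv /= => xs.
    exact: (@ex_derive _ _ _ _ _ _ _ (D _ xs)).
rewrite in_itv /= in ds.
exists c, d; split=> //; move: Ec; rewrite /= in Ed; rewrite Ed /row /= !scale0r !addr0.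
move=> E; transitivity (chi (z + c *: v + d *: w) * (s - 0) * (s - 0)); last by ring.
rewrite -E; ring.
Qed.

Lemma mixed_derive_comm phi psi1 chi1 psi2 chi2 z v w (U : set V) :
  open U -> U z ->
  (forall u, U u -> is_derive u v phi (psi1 u) /\ is_derive u w psi1 (chi1 u)) ->
  (forall u, U u -> is_derive u w phi (psi2 u) /\ is_derive u v psi2 (chi2 u)) ->
  {for z, continuous chi1} -> {for z, continuous chi2} ->
  chi1 z = chi2 z.
Proof.
move=> oU Uz D1 D2 C1 C2; apply/eqP; rewrite -subr_eq0 -normr_le0.
apply/ler_addgt0Pr => e e0; rewrite add0r.
have e20 : 0 < e / 2 by rewrite divr_gt0.
have N : \forall u \near z, [/\ U u,
   `|chi1 z - chi1 u| <= e / 2 & `|chi2 z - chi2 u| <= e / 2].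
  have N0 : nbhs z U by exact: open_nbhs_nbhs.
  have N1 : \forall u \near z, `|chi1 z - chi1 u| <= e / 2.
    by move/cvgrPdist_le: C1; apply.
  have N2 : \forall u \near z, `|chi2 z - chi2 u| <= e / 2.
    by move/cvgrPdist_le: C2; apply.
  by apply: filterS3 N0 N1 N2 => u U0 U1 U2; split.
have [r /= r0 Br] := (iffLR (nbhs_ballP z _)) N.
pose M := `|v| + `|w| + 1; have M0 : 0 < M by rewrite ltr_wpDl ?addr_ge0.
pose s := r / 2 / M; have s0 : 0 < s by rewrite !divr_gt0.
have near_z c d : 0 <= c <= s -> 0 <= d <= s -> ball z r (z + c *: v + d *: w).
  move=> /andP[c0 cs] /andP[d0 ds]; rewrite -ball_normE /ball_ /=.
  rewrite -(addrA z) opprD addrA subrr add0r normrN.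
  apply: (le_lt_trans (ler_normD _ _)); rewrite !normrZ !ger0_norm//.
  have : c * `|v| + d * `|w| <= s * M.
    rewrite /M !mulrDr mulr1 -[leLHS]addr0 !lerD ?ler_wpM2r//; exact: ltW.
  move/le_lt_trans; apply; rewrite /s divfK ?gt_eqF//.
  by rewrite ltr_pdivrMr// ltr_pMr// ltr1n.
have near_z' c d : 0 <= c <= s -> 0 <= d <= s -> ball z r (z + c *: w + d *: v).
  by move=> ? ?; rewrite -addrA (addrC (c *: w)) addrA; apply: near_z.
have H1 c d : 0 <= c <= s -> 0 <= d <= s ->
    is_derive (z + c *: v + d *: w) v phi (psi1 (z + c *: v + d *: w)) /\
    is_derive (z + c *: v + d *: w) w psi1 (chi1 (z + c *: v + d *: w)).
  by move=> cs ds; apply: D1; case: (Br _ (near_z c d cs ds)).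
have H2 c d : 0 <= c <= s -> 0 <= d <= s ->
    is_derive (z + c *: w + d *: v) w phi (psi2 (z + c *: w + d *: v)) /\
    is_derive (z + c *: w + d *: v) v psi2 (chi2 (z + c *: w + d *: v)).
  by move=> cs ds; apply: D2; case: (Br _ (near_z' c d cs ds)).
have [c [d [cs ds E1]]] := rectangle_MVT s0 H1.
have [d' [c' [ds' cs' E2]]] := rectangle_MVT s0 H2.
have E : chi1 (z + c *: v + d *: w) = chi2 (z + d' *: w + c' *: v).
  apply: (mulfI (expf_neq0 2 (lt0r_neq0 s0))); rewrite -E1 -E2.
  rewrite -[z + s *: v + _]addrA [s *: v + _]addrC addrA; ring.
have [_ b1 _] := Br _ (near_z _ _ cs ds).
have [_ _ b2] := Br _ (near_z' _ _ ds' cs').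
rewrite -E distrC in b2.
apply: (le_trans (ler_distD (chi1 (z + c *: v + d *: w)) _ _)).
by rewrite (splitr e) lerD.
Qed.

End Schwarz.

(** * Wirtinger derivatives and smooth functions *)

Section Wirtinger.
Context {R : realType}.
Local Notation C := (Rcomplex R).
Implicit Types (z v a b c d : C) (f g : C -> C).

(* [f] has the Wirtinger derivatives [a] (in z) and [b] (in z bar) at [z]. *)
Definition wirt f z a b :=
  is_derive z 1 f (a + b) /\ is_derive z imagunit f (imagunit * (a - b)).

Lemma wirt_derivable f z : derivable f z 1 -> derivable f z imagunit ->
  wirt f z (dz f z) (dzbar f z).
Proof.
have h2 : (2 : C) != 0 by rewrite natrC_eq0.
move=> d1 d2; split; split=> //; rewrite /dz /dzbar.
  by field.
transitivity (- (imagunit * imagunit) * 'D_imagunit f z).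
  by rewrite imagunit2 opprK mul1r.
by field.
Qed.

Lemma wirt_dz f z a b : wirt f z a b -> dz f z = a.
Proof.
move=> [[_ e1] [_ e2]]; rewrite /dz e1 e2 mulrA imagunit2.
have h2 : (2 : C) != 0 by rewrite natrC_eq0.
by field.
Qed.

Lemma wirt_dzbar f z a b : wirt f z a b -> dzbar f z = b.
Proof.
move=> [[_ e1] [_ e2]]; rewrite /dzbar e1 e2 mulrA imagunit2.
have h2 : (2 : C) != 0 by rewrite natrC_eq0.
by field.
Qed.

Lemma wirt_eq f z a b a' b' : wirt f z a b -> a = a' -> b = b' -> wirt f z a' b'.
Proof. by move=> h <- <-. Qed.

Lemma wirt_near f g z a b : (\near z, f z = g z) -> wirt f z a b -> wirt g z a b.
Proof. by move=> fg [h1 h2]; split; apply: near_eq_is_derive fg _. Qed.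

Lemma wirt_open (U : set C) f g z a b : open U -> U z ->
  (forall u, U u -> f u = g u) -> wirt f z a b -> wirt g z a b.
Proof.
move=> oU Uz fg; apply: wirt_near; apply: filterS fg _.
exact: open_nbhs_nbhs.
Qed.

Lemma dz_open (U : set C) f g z : open U -> U z ->
  (forall u, U u -> f u = g u) -> dz f z = dz g z.
Proof.
move=> oU Uz fg; have N : \near z, f z = g z.
  by apply: filterS fg _; exact: open_nbhs_nbhs.
by rewrite /dz !(near_eq_derive _ N).
Qed.

Lemma dzbar_open (U : set C) f g z : open U -> U z ->
  (forall u, U u -> f u = g u) -> dzbar f z = dzbar g z.
Proof.
move=> oU Uz fg; have N : \near z, f z = g z.
  by apply: filterS fg _; exact: open_nbhs_nbhs.
by rewrite /dzbar !(near_eq_derive _ N).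
Qed.

Lemma wirt_cst z c : wirt (fun=> c) z 0 0.
Proof. by split; rewrite ?addr0 ?subr0 ?mulr0; apply: is_derive_cst. Qed.

Lemma wirt_id z : wirt id z 1 0.
Proof. by split; rewrite ?addr0 ?subr0 ?mulr1; apply: is_derive_id. Qed.

Lemma wirtD f g z a b c d : wirt f z a b -> wirt g z c d ->
  wirt (fun u => f u + g u) z (a + c) (b + d).
Proof.
move=> [f1 f2] [g1 g2]; split.
  by rewrite addrACA; exact: is_deriveD f1 g1.
by rewrite opprD addrACA mulrDr; exact: is_deriveD f2 g2.
Qed.

Lemma wirtM f g z a b c d : wirt f z a b -> wirt g z c d ->
  wirt (fun u => f u * g u) z (a * g z + f z * c) (b * g z + f z * d).
Proof.
move=> [f1 f2] [g1 g2]; split.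
  have -> : a * g z + f z * c + (b * g z + f z * d) =
    (a + b) * g z + f z * (c + d) by ring.
  exact: is_deriveMC.
have -> : imagunit * (a * g z + f z * c - (b * g z + f z * d)) =
  imagunit * (a - b) * g z + f z * (imagunit * (c - d)) by ring.
exact: is_deriveMC.
Qed.

Lemma wirtZ f z a b c : wirt f z a b -> wirt (fun u => c * f u) z (c * a) (c * b).
Proof.
move=> h; apply: (wirt_eq (wirtM (wirt_cst z c) h)); by rewrite mul0r add0r.
Qed.

Lemma wirt_sum (I : Type) (r : seq I) (P : pred I) (F A B : I -> C -> C) z :
  (forall i, P i -> wirt (F i) z (A i z) (B i z)) ->
  wirt (fun u => \sum_(i <- r | P i) F i u) z
    (\sum_(i <- r | P i) A i z) (\sum_(i <- r | P i) B i z).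
Proof.
move=> h; elim: r => [|i r IH].
  rewrite !big_nil; under eq_fun do rewrite big_nil; exact: wirt_cst.
rewrite !big_cons; under eq_fun do rewrite big_cons.
by case: ifP => // Pi; apply: wirtD => //; exact: h.
Qed.

Lemma wirt_conj f z a b : wirt f z a b ->
  wirt (fun u => cconj (f u)) z (cconj b) (cconj a).
Proof.
have cD u v : cconj (u + v) = cconj u + cconj v :> C by exact: (rmorphD (@conjc R)).
have cB u v : cconj (u - v) = cconj u - cconj v :> C by exact: (rmorphB (@conjc R)).
have cM u v : cconj (u * v) = cconj u * cconj v :> C by exact: (rmorphM (@conjc R)).
have ci : cconj imagunit = - imagunit :> C by transitivity (Complex (- 0) (- 1) : C) => //; rewrite oppr0.
move=> [f1 f2]; split.
  rewrite addrC -cD; exact: is_derive_conjF.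
have -> : imagunit * (cconj b - cconj a) = cconj (imagunit * (a - b)).
  by rewrite cM cB ci; ring.
exact: is_derive_conjF.
Qed.

Lemma wirt_yinv z : complex.Im z != 0 ->
  wirt yinv z (- yinv z ^+ 2) (yinv z ^+ 2).
Proof.
move=> z0; split.
  have := is_derive_yinv 1 z0; congr is_derive.
  by rewrite subconjE /= mulr0 scale0r oppr0 mul0r addNr.
have := is_derive_yinv imagunit z0; congr is_derive.
rewrite subconjE /= mulr1 scaler_nat; ring.
Qed.

Lemma wirt_exp f z a b n : wirt f z a b ->
  wirt (fun u => f u ^+ n) z (n%:R * a * f z ^+ n.-1) (n%:R * b * f z ^+ n.-1).
Proof.
move=> h; elim: n => [|n IH].
  by rewrite !mul0r; exact: wirt_cst.
have := wirtM h IH; congr wirt.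
- by apply/funext => u; rewrite exprS.
- case: n {IH} => [|n]; first by rewrite /= expr0; ring.
  rewrite /= !exprS -!natr1; ring.
- case: n {IH} => [|n]; first by rewrite /= expr0; ring.
  rewrite /= !exprS -!natr1; ring.
Qed.

End Wirtinger.

Section Smooth.
Context {R : realType}.
Local Notation C := (Rcomplex R).
Variable U : set C.
Hypothesis oU : open U.
Implicit Types (z v a b c d : C) (f g : C -> C).

Lemma eq_derive_open f g v z : U z -> (forall u, U u -> f u = g u) ->
  'D_v f z = 'D_v g z.
Proof.
move=> Uz fg; apply: near_eq_derive; apply: filterS fg _.
exact: open_nbhs_nbhs.
Qed.

Lemma Cn_on_eq n f g : (forall u, U u -> f u = g u) -> Cn_on n U f -> Cn_on n U g.
Proof.
elim: n f g => [|n IH] f g fg /=.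
  move=> h z Uz; have N : \near z, f z = g z.
    by apply: filterS fg _; exact: open_nbhs_nbhs.
  rewrite /prop_for /continuous_at -(fg z Uz); apply: cvg_trans (h z Uz).
  have F : Filter (nbhs (z : C)) by exact: nbhs_filter.
  apply: near_eq_cvg; exact: N.
move=> [h1 h2 h3]; split.
- move=> z Uz; have N : \near z, f z = g z.
    by apply: filterS fg _; exact: open_nbhs_nbhs.
  by have [d1 d2] := h1 z Uz; split; apply: near_eq_derivable N _.
- by apply: IH h2 => u Uu; exact: eq_derive_open.
- by apply: IH h3 => u Uu; exact: eq_derive_open.
Qed.

Lemma smooth_eq f g : (forall u, U u -> f u = g u) -> smooth_on U f -> smooth_on U g.
Proof. by move=> fg h n; apply: Cn_on_eq fg (h n). Qed.

Lemma smooth_D1 f : smooth_on U f -> smooth_on U ('D_1 f).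
Proof. by move=> h n; case: (h n.+1). Qed.

Lemma smooth_Di f : smooth_on U f -> smooth_on U ('D_imagunit f).
Proof. by move=> h n; case: (h n.+1). Qed.

Lemma smooth_cont f z : smooth_on U f -> U z -> {for z, continuous f}.
Proof. by move=> /(_ 0%N); apply. Qed.

Lemma smooth_der1 f z : smooth_on U f -> U z -> is_derive z 1 f ('D_1 f z).
Proof. by move=> /(_ 1%N) [h _ _] /h [? _]; exact: derivableP. Qed.

Lemma smooth_deri f z : smooth_on U f -> U z -> is_derive z imagunit f ('D_imagunit f z).
Proof. by move=> /(_ 1%N) [h _ _] /h [_ ?]; exact: derivableP. Qed.

Lemma smooth_wirt f z : smooth_on U f -> U z -> wirt f z (dz f z) (dzbar f z).
Proof. by move=> /(_ 1%N) [h _ _] /h [? ?]; exact: wirt_derivable. Qed.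

(* Coinduction principle: a class of functions that is stable, up to equality
   on [U], under the two partial derivatives consists of smooth functions. *)
Lemma smooth_coind (P : (C -> C) -> Prop) :
  (forall f, P f ->
    [/\ forall z, U z -> {for z, continuous f},
        exists2 g, P g & forall z, U z -> is_derive z 1 f (g z) &
        exists2 g, P g & forall z, U z -> is_derive z imagunit f (g z)]) ->
  forall f, P f -> smooth_on U f.
Proof.
move=> H f Pf n; elim: n f Pf => [|n IH] f Pf; first by case: (H f Pf).
have [_ [g1 P1 D1] [g2 P2 D2]] := H f Pf; split.
- by move=> z Uz; split; [case: (D1 z Uz)|case: (D2 z Uz)].
- by apply: Cn_on_eq (IH _ P1) => z /D1[].
- by apply: Cn_on_eq (IH _ P2) => z /D2[].
Qed.

Lemma smooth_cst c : smooth_on U (fun=> c).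
Proof.
apply: (@smooth_coind (fun f => exists c, f = fun=> c)); last by exists c.
move=> _ [e ->]; split.
- by move=> z _; exact: cst_continuous.
- by exists (fun=> 0); [exists 0|move=> z _; exact: is_derive_cst].
- by exists (fun=> 0); [exists 0|move=> z _; exact: is_derive_cst].
Qed.

Lemma Cn_onD n f g : Cn_on n U f -> Cn_on n U g -> Cn_on n U (fun z => f z + g z).
Proof.
elim: n f g => [|n IH] f g /=.
  move=> hf hg z Uz; have F : Filter (nbhs (z : C)) by exact: nbhs_filter.
  by apply: cvgD; [exact: hf|exact: hg].
move=> [f0 f1 f2] [g0 g1 g2]; split.
- by move=> z Uz; have [? ?] := f0 z Uz; have [? ?] := g0 z Uz; split; apply: derivableD.
- apply: Cn_on_eq (IH _ _ f1 g1) => z Uz.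
  by have [? ?] := f0 z Uz; have [? ?] := g0 z Uz; rewrite -deriveD.
- apply: Cn_on_eq (IH _ _ f2 g2) => z Uz.
  by have [? ?] := f0 z Uz; have [? ?] := g0 z Uz; rewrite -deriveD.
Qed.

Lemma smoothD f g : smooth_on U f -> smooth_on U g ->
  smooth_on U (fun z => f z + g z).
Proof. by move=> sf sg n; apply: Cn_onD. Qed.

Lemma smooth_sum (I : Type) (r : seq I) (P : pred I) (F : I -> C -> C) :
  (forall i, P i -> smooth_on U (F i)) ->
  smooth_on U (fun z => \sum_(i <- r | P i) F i z).
Proof.
move=> h; elim: r => [|i r IH].
  under eq_fun do rewrite big_nil; exact: smooth_cst.
under eq_fun do rewrite big_cons.
by case Pi: (P i) => //; apply: smoothD => //; exact: h.
Qed.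

Lemma smoothM f g : smooth_on U f -> smooth_on U g ->
  smooth_on U (fun z => f z * g z).
Proof.
move=> sf sg n; elim: n f g sf sg => [|n IH] f g sf sg.
  move=> z Uz; have F : Filter (nbhs (z : C)) by exact: nbhs_filter.
  by apply: cvg_mulC; apply: smooth_cont.
have D1 z : U z -> is_derive z 1 (fun u => f u * g u) ('D_1 f z * g z + f z * 'D_1 g z).
  by move=> Uz; apply: is_deriveMC; exact: smooth_der1.
have Di z : U z -> is_derive z imagunit (fun u => f u * g u)
    ('D_imagunit f z * g z + f z * 'D_imagunit g z).
  by move=> Uz; apply: is_deriveMC; exact: smooth_deri.
split.
- by move=> z Uz; split; [case: (D1 z Uz)|case: (Di z Uz)].
- apply: (@Cn_on_eq _ (fun z => 'D_1 f z * g z + f z * 'D_1 g z)).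
    by move=> z /D1[].
  by apply: Cn_onD; apply: IH => //; exact: smooth_D1.
- apply: (@Cn_on_eq _ (fun z => 'D_imagunit f z * g z + f z * 'D_imagunit g z)).
    by move=> z /Di[].
  by apply: Cn_onD; apply: IH => //; exact: smooth_Di.
Qed.

Lemma smooth_id : smooth_on U id.
Proof.
have h n c : Cn_on n U (fun=> c) by exact: smooth_cst.
case=> [|n] /=; first by move=> z _; exact: cvg_id.
split; first by move=> z _; split; exact: derivable_id.
- by apply: Cn_on_eq (h n 1) => z _; rewrite derive_id.
- by apply: Cn_on_eq (h n imagunit) => z _; rewrite derive_id.
Qed.

Lemma smooth_conj f : smooth_on U f -> smooth_on U (fun z => cconj (f z)).
Proof.
move=> sf; apply: (@smooth_coind (fun h => exists2 f,
  smooth_on U f & h = fun z => cconj (f z))); last by exists f.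
move=> _ [{sf}f sf ->]; split.
- by move=> z Uz; apply: continuous_conjF; exact: smooth_cont.
- exists (fun z => cconj ('D_1 f z)); first by exists ('D_1 f) => //; exact: smooth_D1.
  by move=> z Uz; apply: is_derive_conjF; exact: smooth_der1.
- exists (fun z => cconj ('D_imagunit f z)).
    by exists ('D_imagunit f) => //; exact: smooth_Di.
  by move=> z Uz; apply: is_derive_conjF; exact: smooth_deri.
Qed.

Lemma smooth_exp f n : smooth_on U f -> smooth_on U (fun z => f z ^+ n).
Proof.
move=> sf; elim: n => [|n IH]; first exact: smooth_cst.
by under eq_fun do rewrite exprS; exact: smoothM.
Qed.

Lemma smooth_dz f : smooth_on U f -> smooth_on U (dz f).
Proof.
move=> sf; apply: smoothM; first exact: smooth_cst.
have -> : (fun z => 'D_1 f z - imagunit * 'D_imagunit f z) =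
  (fun z => 'D_1 f z + (- imagunit) * 'D_imagunit f z).
  by apply/funext => z; rewrite mulNr.
apply: smoothD; first exact: smooth_D1.
apply: smoothM; [exact: smooth_cst|exact: smooth_Di].
Qed.

Lemma smooth_dzbar f : smooth_on U f -> smooth_on U (dzbar f).
Proof.
move=> sf; apply: smoothM; first exact: smooth_cst.
apply: smoothD; first exact: smooth_D1.
apply: smoothM; [exact: smooth_cst|exact: smooth_Di].
Qed.

Lemma smooth_yinv : (forall z, U z -> complex.Im z != 0) -> smooth_on U yinv.
Proof.
move=> U0.
have cy z : U z -> {for z, continuous yinv}.
  move=> Uz; have F : Filter (nbhs (z : C)) by exact: nbhs_filter.
  have -> : yinv = fun u : C => (complex.Im u)^-1 *: (2 * imagunit : C)^-1.
    by apply/funext => u; rewrite yinvE.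
  rewrite /prop_for /continuous_at.
  by apply: cvgZr_tmp; apply: cvgV; [exact: U0|exact: continuous_Im].
have Dy z v m c : U z -> is_derive z v (fun u => c * yinv u ^+ m)
    (c * m%:R * - (v - cconj v) * yinv z ^+ m.+1).
  move=> Uz; elim: m c => [|m IH] c.
    rewrite mulr0 !mul0r; under eq_fun do rewrite expr0.
    exact: is_derive_cst.
  have H := is_deriveMC (IH c) (is_derive_yinv v (U0 z Uz)).
  have -> : (fun u => c * yinv u ^+ m.+1) = (fun u => c * yinv u ^+ m * yinv u).
    by apply/funext => u; rewrite exprSr mulrA.
  apply: is_derive_eq H _; rewrite !exprS -natr1; ring.
apply: (@smooth_coind (fun f => exists m c, f = fun z => c * yinv z ^+ m)); last first.
  by exists 1%N, 1; apply/funext => z; rewrite mul1r.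
move=> _ [m [c ->]]; split.
- move=> z Uz; have F : Filter (nbhs (z : C)) by exact: nbhs_filter.
  have cX : (fun u => yinv u ^+ m) @ z --> yinv z ^+ m.
    elim: m => [|m IH]; first exact: cvg_cst.
    have -> : (fun u : C => yinv u ^+ m.+1) = (fun u => yinv u * yinv u ^+ m).
      by apply/funext => u; rewrite exprS.
    by rewrite exprS; apply: cvg_mulC => //; exact: cy.
  by apply: cvg_mulC cX; exact: cvg_cst.
- by eexists; [exists m.+1; eexists; reflexivity|move=> z /Dy].
- by eexists; [exists m.+1; eexists; reflexivity|move=> z /Dy].
Qed.

Lemma smooth_derive_comm f z : smooth_on U f -> U z ->
  'D_imagunit ('D_1 f) z = 'D_1 ('D_imagunit f) z.
Proof.
move=> sf Uz.
have s1 := smooth_D1 sf; have s2 := smooth_Di sf.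
have s12 := smooth_Di s1; have s21 := smooth_D1 s2.
have e1 : complex.Re ('D_imagunit ('D_1 f) z) = complex.Re ('D_1 ('D_imagunit f) z).
  apply: (@mixed_derive_comm _ _ (fun u => complex.Re (f u))
    (fun u => complex.Re ('D_1 f u)) (fun u => complex.Re ('D_imagunit ('D_1 f) u))
    (fun u => complex.Re ('D_imagunit f u)) (fun u => complex.Re ('D_1 ('D_imagunit f) u))
    z 1 imagunit U oU Uz).
  - by move=> u Uu; split; apply: is_derive_ReF; [exact: smooth_der1|exact: smooth_deri].
  - by move=> u Uu; split; apply: is_derive_ReF; [exact: smooth_deri|exact: smooth_der1].
  - exact: cvg_comp (smooth_cont s12 Uz) (@continuous_Re _ _).
  - exact: cvg_comp (smooth_cont s21 Uz) (@continuous_Re _ _).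
have e2 : complex.Im ('D_imagunit ('D_1 f) z) = complex.Im ('D_1 ('D_imagunit f) z).
  apply: (@mixed_derive_comm _ _ (fun u => complex.Im (f u))
    (fun u => complex.Im ('D_1 f u)) (fun u => complex.Im ('D_imagunit ('D_1 f) u))
    (fun u => complex.Im ('D_imagunit f u)) (fun u => complex.Im ('D_1 ('D_imagunit f) u))
    z 1 imagunit U oU Uz).
  - by move=> u Uu; split; apply: is_derive_ImF; [exact: smooth_der1|exact: smooth_deri].
  - by move=> u Uu; split; apply: is_derive_ImF; [exact: smooth_deri|exact: smooth_der1].
  - exact: cvg_comp (smooth_cont s12 Uz) (@continuous_Im _ _).
  - exact: cvg_comp (smooth_cont s21 Uz) (@continuous_Im _ _).
by rewrite (complexZE ('D_imagunit ('D_1 f) z)) e1 e2 -complexZE.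
Qed.

End Smooth.

(** * Raising and lowering operators *)

Section Operators.
Context {R : realType}.
Local Notation C := (Rcomplex R).
Implicit Types (z : C) (f g : C -> C) (k w : int).

Lemma domain_open (S : set C) : discrete_in_half_plane S -> open (domain S).
Proof.
move=> [_ S0]; rewrite openE => z [zH zS].
have F : Filter (nbhs (z : C)) by exact: nbhs_filter.
have nS : nbhs z (~` S).
  apply: contrapT => nn; have : (limit_point S `&` @upper_half_plane R) z.
    split=> // V zV; apply: contrapT => nV; apply: nn; apply: filterS zV => u Vu Su.
    by apply: nV; exists u; split=> //; apply/eqP => uz; apply: zS; rewrite -uz.
  by rewrite S0.
have nH : nbhs z (@upper_half_plane R).
  apply: (@continuous_Im R z [set x | 0 < x]).
  by apply: open_nbhs_nbhs; split => //; exact: open_gt.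
by apply: filterS2 nH nS => u; split.
Qed.

Lemma domain_Im (S : set C) z : domain S z -> complex.Im z != 0.
Proof. by move=> [/= H _]; rewrite gt_eqF. Qed.

Definition casimir (k w : int) : C := ((w + 2 * k) * (w - 2 * k + 2))%:~R / 4.

Lemma casimirE k w :
  (k * (1 - k))%:~R + (w * (w - 2))%:~R / 4 = casimir k w - w%:~R.
Proof.
have h4 : (4 : C) != 0 by rewrite natrC_eq0.
rewrite /casimir !(intrM, intrD, intrB); by field.
Qed.

Lemma casimirS k w :
  (k * (1 - k))%:~R + ((w + 2) * (w + 2 - 2))%:~R / 4 = casimir k w.
Proof.
have h4 : (4 : C) != 0 by rewrite natrC_eq0.
rewrite /casimir !(intrM, intrD, intrB); by field.
Qed.

Lemma delta_invE k w f z : delta_inv k w f z = (casimir k w)^-1 * delta_minus f z.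
Proof. by rewrite /delta_inv /casimir invf_div. Qed.

Lemma deltaE w f z : delta w f z = dz f z + w%:~R * yinv z * f z.
Proof. by []. Qed.

Lemma wirt_subconj z : wirt (fun u : C => u - cconj u) z 1 (- 1).
Proof.
have h := wirtD (wirt_id z) (wirtZ (- 1) (wirt_conj (wirt_id z))).
have c1 : cconj 1 = 1 :> C by exact: (rmorph1 (@conjc R)).
have c0 : cconj 0 = 0 :> C by exact: (rmorph0 (@conjc R)).
move: h; rewrite c1 c0 mulr0 addr0 mulr1 add0r; congr wirt.
by apply/funext => u; rewrite mulN1r.
Qed.

Variable U : set C.
Hypothesis oU : open U.
Hypothesis UIm : forall z, U z -> complex.Im z != 0.

Lemma dz_dzbar_comm f z : smooth_on U f -> U z -> dz (dzbar f) z = dzbar (dz f) z.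
Proof.
move=> sf Uz.
have h1 := smooth_wirt (smooth_D1 sf) Uz.
have h2 := smooth_wirt (smooth_Di sf) Uz.
rewrite (wirt_dz (wirtZ 2^-1 (wirtD h1 (wirtZ imagunit h2)))).
have := wirt_dzbar (wirtZ 2^-1 (wirtD h1 (wirtZ (- imagunit) h2))).
have -> : (fun u => 2^-1 * ('D_1 f u + - imagunit * 'D_imagunit f u)) = dz f.
  by apply/funext => u; rewrite mulNr.
move=> ->; rewrite /dz /dzbar (smooth_derive_comm oU sf Uz); ring.
Qed.

Lemma smooth_delta w f : smooth_on U f -> smooth_on U (delta w f).
Proof.
move=> sf; apply: (smoothD oU); first exact: smooth_dz.
apply: (smoothM oU) => //; apply: (smoothM oU); first exact: smooth_cst.
exact: (smooth_yinv oU UIm).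
Qed.

Lemma smooth_subconj : smooth_on U (fun z => z - cconj z).
Proof.
have -> : (fun z : C => z - cconj z) = (fun z => id z + (- 1) * cconj (id z)).
  by apply/funext => z; rewrite mulN1r.
apply: (smoothD oU); first exact: smooth_id.
apply: (smoothM oU); first exact: smooth_cst.
by apply: (smooth_conj oU); exact: smooth_id.
Qed.

Lemma smooth_delta_minus f : smooth_on U f -> smooth_on U (delta_minus f).
Proof.
move=> sf; apply: (smoothM oU); last exact: smooth_dzbar.
by apply: (smooth_exp oU); exact: smooth_subconj.
Qed.

Lemma smooth_delta_inv k w f : smooth_on U f -> smooth_on U (delta_inv k w f).
Proof.
move=> sf; apply: (smoothM oU); first exact: smooth_cst.
exact: smooth_delta_minus.
Qed.

Lemma eq_delta w f g z : U z -> (forall u, U u -> f u = g u) ->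
  delta w f z = delta w g z.
Proof. by move=> Uz fg; rewrite !deltaE (dz_open oU Uz fg) fg. Qed.

Lemma eq_delta_minus f g z : U z -> (forall u, U u -> f u = g u) ->
  delta_minus f z = delta_minus g z.
Proof. by move=> Uz fg; rewrite /delta_minus (dzbar_open oU Uz fg). Qed.

Lemma deltaZ w c f z : smooth_on U f -> U z ->
  delta w (fun u => c * f u) z = c * delta w f z.
Proof.
move=> sf Uz; rewrite !deltaE (wirt_dz (wirtZ c (smooth_wirt sf Uz))); ring.
Qed.

Lemma delta_delta_minus w f z : smooth_on U f -> U z ->
  delta w (delta_minus f) z = Laplace (w + 2) f z.
Proof.
move=> sf Uz.
have h := wirtM (wirt_exp 2 (wirt_subconj z)) (smooth_wirt (smooth_dzbar oU sf) Uz).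
rewrite deltaE (wirt_dz h) /Laplace /delta_minus /= expr1 -/(yinv z) intrD.
have y0 := yinv_neq0 (UIm Uz); rewrite (subconjV z).
by field.
Qed.

Lemma delta_minus_delta w f z : smooth_on U f -> U z ->
  delta_minus (delta w f) z = Laplace w f z + w%:~R * f z.
Proof.
move=> sf Uz.
have h := wirtD (smooth_wirt (smooth_dz oU sf) Uz)
  (wirtM (wirtZ w%:~R (wirt_yinv (UIm Uz))) (smooth_wirt sf Uz)).
have E : delta w f = fun u => dz f u + w%:~R * yinv u * f u by apply/funext.
rewrite /delta_minus E (wirt_dzbar h) /Laplace (dz_dzbar_comm sf Uz).
have y0 := yinv_neq0 (UIm Uz); rewrite (subconjV z).
by field.
Qed.

End Operators.

Section Eigenspaces.
Context {R : realType}.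
Local Notation C := (Rcomplex R).
Implicit Types (z : C) (f g : C -> C) (k w : int).
Variable S : set C.
Hypothesis hS : discrete_in_half_plane S.

Lemma F_delta_minus_delta k w f z : F k w S f -> domain S z ->
  delta_minus (delta w f) z = casimir k w * f z.
Proof.
have oU := domain_open hS; have UIm := @domain_Im R S.
move=> [sf Lf] Uz; rewrite (delta_minus_delta oU UIm w sf Uz) Lf// casimirE; ring.
Qed.

Lemma F_delta k w f : F k w S f -> F k (w + 2) S (delta w f).
Proof.
have oU := domain_open hS; have UIm := @domain_Im R S.
move=> Ff; have [sf Lf] := Ff; have sd := smooth_delta oU UIm w sf.
split=> // z Uz; rewrite -(delta_delta_minus oU UIm w sd Uz) casimirS.
rewrite (eq_delta oU w Uz (fun u Uu => F_delta_minus_delta Ff Uu)).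
exact: deltaZ.
Qed.

Lemma F_delta_delta_inv k w f z : casimir k w != 0 :> C -> F k (w + 2) S f ->
  domain S z -> delta w (delta_inv k w f) z = f z.
Proof.
have oU := domain_open hS; have UIm := @domain_Im R S.
move=> c0 [sf Lf] Uz.
rewrite (eq_delta oU w Uz (fun u _ => delta_invE k w f u)).
rewrite (deltaZ w _ (smooth_delta_minus oU sf) Uz) (delta_delta_minus oU UIm w sf Uz).
by rewrite Lf// casimirS mulKf.
Qed.

Lemma F_delta_inv k w f : casimir k w != 0 :> C -> F k (w + 2) S f ->
  F k w S (delta_inv k w f).
Proof.
have oU := domain_open hS; have UIm := @domain_Im R S.
move=> c0 Ff; have [sf Lf] := Ff; have sd := smooth_delta_inv oU k w sf.
split=> // z Uz; have := delta_minus_delta oU UIm w sd Uz.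
rewrite (eq_delta_minus oU Uz (fun u Uu => F_delta_delta_inv c0 Ff Uu)) => e.
have -> : Laplace w (delta_inv k w f) z =
    delta_minus f z - w%:~R * delta_inv k w f z by rewrite e addrK.
by rewrite casimirE mulrBl delta_invE mulVKf.
Qed.

End Eigenspaces.

(** * Polynomial-valued functions *)

Section PolyValued.
Context {R : realType}.
Local Notation C := (Rcomplex R).
Implicit Types (z a b : C) (G H : C -> {poly C}) (A B : {poly C}).

Definition wirtp G z A B := forall i, wirt (fun u => (G u)`_i) z A`_i B`_i.

Lemma wirtp_eq G z A B A' B' : wirtp G z A B -> A = A' -> B = B' -> wirtp G z A' B'.
Proof. by move=> h <- <-. Qed.

Lemma wirtpC (f : C -> C) z a b : wirt f z a b ->
  wirtp (fun u => (f u)%:P) z a%:P b%:P.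
Proof.
move=> h i; under eq_fun do rewrite coefC.
by rewrite !coefC; case: (i == 0)%N => //; exact: wirt_cst.
Qed.

Lemma wirtp_cst A z : wirtp (fun=> A) z 0 0.
Proof. by move=> i; rewrite !coef0; exact: wirt_cst. Qed.

Lemma wirtpD G H z A B A' B' : wirtp G z A B -> wirtp H z A' B' ->
  wirtp (fun u => G u + H u) z (A + A') (B + B').
Proof.
move=> h h' i; under eq_fun do rewrite coefD.
by rewrite !coefD; exact: wirtD.
Qed.

Lemma wirtpM G H z A B A' B' : wirtp G z A B -> wirtp H z A' B' ->
  wirtp (fun u => G u * H u) z (A * H z + G z * A') (B * H z + G z * B').
Proof.
move=> h h' i; under eq_fun do rewrite coefM.
rewrite !coefD !coefM -!big_split /=.
apply: (@wirt_sum _ _ _ _ _ (fun j _ => _) (fun j _ => _)) => j _.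
exact: wirtM.
Qed.

Lemma wirtpZ (f : C -> C) G z a b A B : wirt f z a b -> wirtp G z A B ->
  wirtp (fun u => f u *: G u) z (a *: G z + f z *: A) (b *: G z + f z *: B).
Proof.
move=> h h' i; under eq_fun do rewrite coefZ.
by rewrite !coefD !coefZ; exact: wirtM.
Qed.

Lemma wirtp_sum (I : Type) (r : seq I) (P : pred I) (G : I -> C -> {poly C})
    (A B : I -> {poly C}) z :
  (forall i, P i -> wirtp (G i) z (A i) (B i)) ->
  wirtp (fun u => \sum_(i <- r | P i) G i u) z
    (\sum_(i <- r | P i) A i) (\sum_(i <- r | P i) B i).
Proof.
move=> h j; under eq_fun do rewrite coef_sum.
rewrite !coef_sum.
by apply: (@wirt_sum _ _ _ _ _ (fun i _ => _) (fun i _ => _)) => i Pi; exact: h.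
Qed.

Lemma wirtp_exp G z A B n : wirtp G z A B ->
  wirtp (fun u => G u ^+ n) z (n%:R * A * G z ^+ n.-1) (n%:R * B * G z ^+ n.-1).
Proof.
move=> h; elim: n => [|n IH].
  by rewrite !mul0r; exact: wirtp_cst.
have := wirtpM h IH; congr wirtp.
- by apply/funext => u; rewrite exprS.
- case: n {IH} => [|n]; first by rewrite /= expr0; ring.
  rewrite /= !exprS -!natr1; ring.
- case: n {IH} => [|n]; first by rewrite /= expr0; ring.
  rewrite /= !exprS -!natr1; ring.
Qed.

Lemma coefwise_dz n G z A B : wirtp G z A B -> (size A <= n.+1)%N ->
  coefwise n (@dz R) G z = A.
Proof.
move=> h sA; apply/polyP => i; rewrite coef_poly; case: ltnP => ni.
  exact: wirt_dz (h i).
by rewrite nth_default// (leq_trans sA).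
Qed.

Lemma coefwise_dzbar n G z A B : wirtp G z A B -> (size B <= n.+1)%N ->
  coefwise n (@dzbar R) G z = B.
Proof.
move=> h sA; apply/polyP => i; rewrite coef_poly; case: ltnP => ni.
  exact: wirt_dzbar (h i).
by rewrite nth_default// (leq_trans sA).
Qed.

Section Smooth.
Variable U : set C.
Hypothesis oU : open U.

Definition smoothp G := forall i, smooth_on U (fun u => (G u)`_i).

Lemma smoothpC (f : C -> C) : smooth_on U f -> smoothp (fun u => (f u)%:P).
Proof.
move=> h i; under eq_fun do rewrite coefC.
by case: (i == 0)%N => //; exact: smooth_cst.
Qed.

Lemma smoothp_cst A : smoothp (fun=> A).
Proof. by move=> i; exact: smooth_cst. Qed.

Lemma smoothpD G H : smoothp G -> smoothp H -> smoothp (fun u => G u + H u).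
Proof. by move=> h h' i; under eq_fun do rewrite coefD; exact: smoothD. Qed.

Lemma smoothpM G H : smoothp G -> smoothp H -> smoothp (fun u => G u * H u).
Proof.
move=> h h' i; under eq_fun do rewrite coefM.
by apply: (smooth_sum oU) => j _; exact: smoothM.
Qed.

Lemma smoothpZ (f : C -> C) G : smooth_on U f -> smoothp G ->
  smoothp (fun u => f u *: G u).
Proof. by move=> h h' i; under eq_fun do rewrite coefZ; exact: smoothM. Qed.

Lemma smoothp_sum (I : Type) (r : seq I) (P : pred I) (G : I -> C -> {poly C}) :
  (forall i, P i -> smoothp (G i)) -> smoothp (fun u => \sum_(i <- r | P i) G i u).
Proof.
move=> h j; under eq_fun do rewrite coef_sum.
by apply: (smooth_sum oU) => i Pi; exact: h.
Qed.

Lemma smoothp_exp G n : smoothp G -> smoothp (fun u => G u ^+ n).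
Proof.
move=> h; elim: n => [|n IH]; first exact: smoothp_cst.
by under eq_fun do rewrite exprS; exact: smoothpM.
Qed.

End Smooth.
End PolyValued.

Section Basis.
Context {R : realType}.
Local Notation C := (Rcomplex R).
Implicit Types (z : C) (m n j : nat).

Definition zbasis n m z : {poly C} :=
  (m`!)%:R^-1 *: ('X - z%:P) ^+ m *
  (yinv z *: ('X - (cconj z)%:P)) ^+ (n - m).

Lemma size_zbasis n m z : (m <= n)%N -> (size (zbasis n m z) <= n.+1)%N.
Proof.
move=> mn; rewrite /zbasis.
have h1 : (size ((m`!)%:R^-1 *: ('X - z%:P) ^+ m) <= m.+1)%N.
  by apply: (leq_trans (size_scale_leq _ _)); rewrite size_exp_XsubC.
have h2 : (size ((yinv z *: ('X - (cconj z)%:P)) ^+ (n - m)) <= (n - m).+1)%N.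
  by rewrite exprZn; apply: (leq_trans (size_scale_leq _ _)); rewrite size_exp_XsubC.
apply: (leq_trans (size_polyMleq _ _)); rewrite -subn1 leq_subLR add1n.
by apply: (leq_trans (leq_add h1 h2)); rewrite addSn addnS subnKC.
Qed.

Lemma XsubC_yinv z : complex.Im z != 0 ->
  yinv z *: ('X - z%:P) + 1 = yinv z *: ('X - (cconj z)%:P).
Proof.
move=> z0; have y0 := yinv_neq0 z0.
have -> : (1 : {poly C}) = yinv z *: (z - cconj z)%:P.
  by rewrite subconjV -mul_polyC -polyCM mulfV.
rewrite -scalerDr polyCB; congr (_ *: _); ring.
Qed.

Lemma wirtp_XsubC z : wirtp (fun u : C => 'X - u%:P) z (- 1) 0.
Proof.
have h := wirtpD (wirtp_cst 'X z) (wirtpC (wirtZ (- 1) (wirt_id z))).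
move: h; rewrite mulr1 mulr0 !add0r polyCN; congr wirtp.
by apply/funext => u; rewrite mulN1r polyCN.
Qed.

Lemma wirtp_XsubCconj z : wirtp (fun u : C => 'X - (cconj u)%:P) z 0 (- 1).
Proof.
have c1 : cconj 1 = 1 :> C by exact: (rmorph1 (@conjc R)).
have c0 : cconj 0 = 0 :> C by exact: (rmorph0 (@conjc R)).
have h := wirtpD (wirtp_cst 'X z) (wirtpC (wirtZ (- 1) (wirt_conj (wirt_id z)))).
move: h; rewrite c1 c0 mulr1 mulr0 !add0r polyCN; congr wirtp.
by apply/funext => u; rewrite mulN1r polyCN.
Qed.

Lemma wirtp_yXsubCconj z j : complex.Im z != 0 ->
  wirtp (fun u : C => (yinv u *: ('X - (cconj u)%:P)) ^+ j) z
    (- (j%:R * yinv z) *: (yinv z *: ('X - (cconj z)%:P)) ^+ j)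
    ((j%:R * yinv z ^+ 2) *: (('X - z%:P) * (yinv z *: ('X - (cconj z)%:P)) ^+ j.-1)).
Proof.
move=> z0; have e := XsubC_yinv z0.
apply: (wirtp_eq (wirtp_exp j (wirtpZ (wirt_yinv z0) (wirtp_XsubCconj z)))).
  case: j => [|j]; first by rewrite !mul0r oppr0 scale0r.
  rewrite /= scaler0 addr0 !exprS expr0 mulr1 -!mul_polyC !(polyCM, polyCN) polyC_natr.
  ring.
have -> : yinv z ^+ 2 *: ('X - (cconj z)%:P) + yinv z *: -1 = yinv z ^+ 2 *: ('X - z%:P).
  by rewrite expr2 -!scalerA -scalerDr -e; congr (_ *: _); ring.
rewrite expr2 -!mul_polyC !(polyCM, polyCN) polyC_natr; ring.
Qed.

Lemma wirtp_zbasis n m z : complex.Im z != 0 -> (m <= n)%N ->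
  wirtp (zbasis n m) z
    (- (zbasis n m.-1 z *+ (0 < m)%N) + ((m%:R *+ 2 - n%:R) * yinv z) *: zbasis n m z)
    ((((n - m) * m.+1)%:R * yinv z ^+ 2) *: zbasis n m.+1 z).
Proof.
move=> z0 mn; have e := XsubC_yinv z0.
have h0 := wirtpZ (wirt_cst z (m`!)%:R^-1) (wirtp_exp m (wirtp_XsubC z)).
apply: (wirtp_eq (wirtpM h0 (wirtp_yXsubCconj (n - m) z0))).
  have -> : (n%:R : C) = m%:R + (n - m)%:R by rewrite -natrD subnKC.
  case: m mn {h0} => [|m] mn.
    rewrite /zbasis subn0 /= mulr0n oppr0 add0r scale0r add0r !mul0r scaler0 mul0r add0r.
    by rewrite -scalerAr; congr (_ *: _); ring.
  rewrite [m.+1.-1]/= mulr1n /zbasis -(subnSK mn).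
  set q := (n - m.+1)%N; set P := yinv z *: ('X - (cconj z)%:P) in e *.
  have -> : ((m`!)%:R^-1 : C) = m.+1%:R * (m.+1)`!%:R^-1.
    by rewrite factS natrM invfM mulrA mulfV ?mul1r// natrC_eq0.
  have eP : P ^+ q.+1 = ((yinv z)%:P * ('X - z%:P) + 1) * P ^+ q.
    by rewrite exprS mul_polyC e.
  rewrite scale0r add0r eP.
  rewrite -!mul_polyC mulr2n !(polyCM, polyCN, polyCD) !polyC_natr !exprS; ring.
rewrite scale0r add0r mulr0 mul0r scaler0 mul0r add0r.
have [->|nm] := eqVneq (n - m)%N 0%N.
  by rewrite !(mul0n, mulr0n, mul0r, scale0r, mulr0).
rewrite /zbasis (_ : n - m.+1 = (n - m).-1)%N; last by rewrite subnS.
set q := (n - m)%N; set P := yinv z *: ('X - (cconj z)%:P).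
have -> : ((m`!)%:R^-1 : C) = m.+1%:R * (m.+1)`!%:R^-1.
  by rewrite factS natrM invfM mulrA mulfV ?mul1r// natrC_eq0.
rewrite expr2 -!mul_polyC !exprS natrM !(polyCM, polyCN, polyCD) !polyC_natr.
ring.
Qed.

Lemma smoothp_zbasis (U : set C) n m : open U -> (forall z, U z -> complex.Im z != 0) ->
  smoothp U (zbasis n m).
Proof.
move=> oU UIm; have sX (f : C -> C) : smooth_on U f -> smoothp U (fun z => 'X - (f z)%:P).
  move=> sf; have -> : (fun z => 'X - (f z)%:P) = (fun z => 'X + (- 1 * f z)%:P).
    by apply/funext => z; rewrite mulN1r polyCN.
  apply: (smoothpD oU); first exact: smoothp_cst.
  by apply: (smoothpC oU); apply: (smoothM oU) => //; exact: smooth_cst.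
apply: (smoothpM oU).
  apply: (smoothpZ oU); first exact: smooth_cst.
  by apply: (smoothp_exp oU); apply: sX; exact: smooth_id.
apply: (smoothp_exp oU); apply: (smoothpZ oU); first exact: smooth_yinv.
by apply: (sX (fun z => cconj (id z))); apply: (smooth_conj oU); exact: smooth_id.
Qed.

End Basis.

(** * Ladders *)

Section Ladder.
Context {R : realType}.
Local Notation C := (Rcomplex R).
Implicit Types (z : C) (f : C -> C) (n m p : nat).
Variable U : set C.
Hypothesis oU : open U.
Hypothesis UIm : forall z, U z -> complex.Im z != 0.

(* [T m] has weight [2 m - n]. *)
Definition ladder n (T : nat -> C -> C) :=
  [/\ forall m, (m <= n)%N -> smooth_on U (T m),
      forall m z, (m < n)%N -> U z ->
        delta (2 * m%:Z - n%:Z) (T m) z = T m.+1 z &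
      forall m z, (m < n)%N -> U z ->
        delta_minus (T m.+1) z = - (m.+1 * (n - m))%:R * T m z].

Lemma ladder_sum n T z : ladder n T -> U z ->
  wirtp (fun u => \sum_(m < n.+1) T m u *: zbasis n m u) z
    (delta n%:Z (T n) z *: zbasis n n z) (dzbar (T 0%N) z *: zbasis n 0 z).
Proof.
move=> [sT Tz Tzb] Uz; have z0 := UIm Uz; have y0 := yinv_neq0 z0.
pose A m := dz (T m) z *: zbasis n m z + T m z *: (- (zbasis n m.-1 z *+ (0 < m)%N) +
  ((m%:R *+ 2 - n%:R) * yinv z) *: zbasis n m z).
pose B m := dzbar (T m) z *: zbasis n m z + T m z *: ((((n - m) * m.+1)%:R * yinv z ^+ 2) *:
  zbasis n m.+1 z).
have h (m : 'I_n.+1) : wirtp (fun u => T m u *: zbasis n m u) z (A m) (B m).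
  have mn : (m <= n)%N by rewrite -ltnS.
  have wT := smooth_wirt (sT m mn) Uz.
  have wb := wirtp_zbasis z0 mn.
  exact: wirtpZ wT wb.
have H := @wirtp_sum R 'I_n.+1 (index_enum _) xpredT
  (fun (m : 'I_n.+1) u => T m u *: zbasis n m u)
  (fun m : 'I_n.+1 => A m) (fun m : 'I_n.+1 => B m) z (fun (i : 'I_n.+1) _ => h i).
apply: (wirtp_eq H); rewrite /A /B {A B h H}.
- pose D m := if (m == n)%N then delta n%:Z (T n) z else T m.+1 z.
  have dzT m : (m <= n)%N -> dz (T m) z = D m - (m%:R *+ 2 - n%:R) * yinv z * T m z.
    move=> mn; have Dm : D m = delta (2 * m%:Z - n%:Z) (T m) z.
      rewrite /D; case: eqP => [->|/eqP nm]; last by rewrite Tz// ltn_neqAle nm.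
      by congr (delta _ _ _); lia.
    rewrite Dm deltaE intrB intrM; ring.
  transitivity (\sum_(m < n.+1) (D m *: zbasis n m z - T m z *: (zbasis n m.-1 z *+ (0 < m)%N))).
    apply: eq_bigr => m _; rewrite dzT; last by rewrite -ltnS.
    rewrite scalerBl scalerDr scalerN scalerA [T m z * _]mulrC; ring.
  rewrite sumrB big_ord_recr /= /D eqxx big_ord_recl /= mulr0n scaler0 add0r addrAC.
  apply/eqP; rewrite -subr_eq0 addrK; apply/eqP.
  rewrite -sumrB big1// => m _; rewrite /bump /= add1n add0n mulr1n.
  by rewrite ltn_eqF ?ltn_ord// subrr.
- have dzbT m : (m < n)%N -> dzbar (T m.+1) z = - (m.+1 * (n - m))%:R * yinv z ^+ 2 * T m z.
    move=> mn; have := Tzb m z mn Uz; rewrite /delta_minus (subconjV z) => e.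
    by apply: (mulfI (expf_neq0 2 (invr_neq0 y0))); rewrite e; field.
  rewrite big_split /= [X in X + _]big_ord_recl [X in _ + X]big_ord_recr /=.
  rewrite subnn mul0n mulr0n mul0r scale0r scaler0 addr0 -addrA -big_split /=.
  rewrite big1 ?addr0// => m _.
  rewrite /bump /= add1n dzbT// scalerA -scalerDl.
  rewrite [X in X *: _](_ : _ = 0) ?scale0r//.
  rewrite mulnC; ring.
Qed.

Lemma delta_powN k w f p : delta_pow k w (- p%:Z) f = delta_inv_iter k w p f.
Proof. by case: p. Qed.

Lemma casimir_nat (k m : nat) : (1 <= k)%N -> (m < 2 * k - 2)%N ->
  casimir k%:Z (2 * m%:Z - (2 * k - 2)%N%:Z) = - (m.+1 * (2 * k - 2 - m))%:R :> C.
Proof.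
move=> k1 mn; have h4 : (4 : C) != 0 by rewrite natrC_eq0.
rewrite /casimir; have -> : ((2 * m%:Z - (2 * k - 2)%N%:Z + 2 * k%:Z) *
    (2 * m%:Z - (2 * k - 2)%N%:Z - 2 * k%:Z + 2) : int) =
  - 4 * (m.+1 * (2 * k - 2 - m))%N%:Z by nia.
by rewrite intrM -pmulrn intrN; field.
Qed.

Lemma casimir_nat_neq0 (k m : nat) : (1 <= k)%N -> (m < 2 * k - 2)%N ->
  casimir k%:Z (2 * m%:Z - (2 * k - 2)%N%:Z) != 0 :> C.
Proof. by move=> k1 mn; rewrite casimir_nat// oppr_eq0 natrC_eq0 muln_eq0 subn_eq0 -ltnNge. Qed.

Lemma ladder_pow (k m : nat) T z : (1 <= k)%N -> ladder (2 * k - 2) T ->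
  (m <= 2 * k - 2)%N -> U z ->
  delta_pow k%:Z 0 (m%:Z - (k%:Z - 1)) (T (k - 1)%N) z = T m z.
Proof.
move=> k1 [sT Tz Tzb] mn Uz; have [km|mk] := leqP (k - 1) m.
  have [p mE] : exists p, m = (k - 1 + p)%N by exists (m - (k - 1))%N; lia.
  have -> : m%:Z - (k%:Z - 1) = p%:Z by lia.
  rewrite {}mE in mn *; rewrite /=.
  elim: p mn z Uz => [|p IH] mn z Uz; first by rewrite /= addn0.
  rewrite /= (eq_delta oU _ Uz (IH _)); last lia.
  have := Tz (k - 1 + p)%N z _ Uz; rewrite addnS => <-; last lia.
  by congr (delta _ _ _); lia.
have [p mE] : exists p, (k - 1 = m + p)%N by exists (k - 1 - m)%N; lia.
have -> : m%:Z - (k%:Z - 1) = - p%:Z by lia.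
rewrite delta_powN mE; elim: p m mE {mn mk} z Uz => [|p IH] m mE z Uz.
  by rewrite /= addn0.
have mE' : (k - 1 = m.+1 + p)%N by lia.
rewrite /= delta_invE -mE mE' (eq_delta_minus oU Uz (IH _ mE')).
have mn : (m < 2 * k - 2)%N by lia.
have -> : (0 - 2 * p.+1%:Z : int) = 2 * m%:Z - (2 * k - 2)%N%:Z by lia.
by rewrite Tzb// -casimir_nat// mulKf// casimir_nat_neq0.
Qed.

End Ladder.

Section EigenLadder.
Context {R : realType}.
Local Notation C := (Rcomplex R).
Implicit Types (z : C) (f : C -> C).
Variable S : set C.
Hypothesis hS : discrete_in_half_plane S.
Variables (k : nat) (f : C -> C).
Hypothesis k1 : (1 <= k)%N.
Hypothesis Ff : F k%:Z 0 S f.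

Let T (m : nat) := delta_pow k%:Z 0 (m%:Z - (k%:Z - 1)) f.

Lemma F_delta_iter p : F k%:Z (2 * p%:Z) S (delta_iter 0 p f).
Proof.
elim: p => [|p IH] //=; rewrite add0r.
have -> : 2 * p.+1%:Z = 2 * p%:Z + 2 by lia.
exact: F_delta.
Qed.

Lemma F_delta_inv_iter p : (p <= k - 1)%N ->
  F k%:Z (- (2 * p%:Z)) S (delta_inv_iter k%:Z 0 p f).
Proof.
elim: p => [|p IH] pk //=; rewrite sub0r.
apply: F_delta_inv => //.
  have -> : - (2 * p.+1%:Z) = 2 * (k - 1 - p.+1)%N%:Z - (2 * k - 2)%N%:Z by lia.
  by apply: casimir_nat_neq0 => //; lia.
have -> : - (2 * p.+1%:Z) + 2 = - (2 * p%:Z) by lia.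
by apply: IH; lia.
Qed.

Lemma F_ladder : ladder (domain S) (2 * k - 2) T.
Proof.
have FT m : (m <= 2 * k - 2)%N -> F k%:Z (2 * m%:Z - (2 * k - 2)%N%:Z) S (T m).
  move=> mn; rewrite /T; have [km|mk] := leqP (k - 1) m.
    have -> : m%:Z - (k%:Z - 1) = (m - (k - 1))%N%:Z by lia.
    have -> : 2 * m%:Z - (2 * k - 2)%N%:Z = 2 * (m - (k - 1))%N%:Z by lia.
    exact: F_delta_iter.
  have -> : m%:Z - (k%:Z - 1) = - (k - 1 - m)%N%:Z by lia.
  have -> : 2 * m%:Z - (2 * k - 2)%N%:Z = - (2 * (k - 1 - m)%N%:Z) by lia.
  by rewrite delta_powN; apply: F_delta_inv_iter; lia.
split=> [m mn|m z mn Uz|m z mn Uz]; first by case: (FT m mn).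
  have [km|mk] := leqP (k - 1) m.
    rewrite /T.
    have -> : m.+1%:Z - (k%:Z - 1) = (m - (k - 1)).+1%N%:Z by lia.
    have -> : m%:Z - (k%:Z - 1) = (m - (k - 1))%N%:Z by lia.
    by rewrite /=; congr (delta _ _ _); lia.
  have TE : T m = delta_inv k%:Z (2 * m%:Z - (2 * k - 2)%N%:Z) (T m.+1).
    rewrite /T.
    have -> : m%:Z - (k%:Z - 1) = - (k - 1 - m.+1).+1%:Z by lia.
    have -> : m.+1%:Z - (k%:Z - 1) = - (k - 1 - m.+1)%N%:Z by lia.
    by rewrite !delta_powN /=; congr delta_inv; lia.
  rewrite TE (F_delta_delta_inv hS) ?casimir_nat_neq0//.
  by have := FT m.+1 mn; congr (F _ _ _ _); lia.
have [km|mk] := leqP (k - 1) m.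
  have TE : T m.+1 = delta (2 * m%:Z - (2 * k - 2)%N%:Z) (T m).
    rewrite /T.
    have -> : m.+1%:Z - (k%:Z - 1) = (m - (k - 1)).+1%N%:Z by lia.
    have -> : m%:Z - (k%:Z - 1) = (m - (k - 1))%N%:Z by lia.
    by rewrite /=; congr delta; lia.
  rewrite TE (F_delta_minus_delta hS (FT m (ltnW mn)) Uz).
  by rewrite casimir_nat.
have TE : T m = delta_inv k%:Z (2 * m%:Z - (2 * k - 2)%N%:Z) (T m.+1).
  rewrite /T.
  have -> : m%:Z - (k%:Z - 1) = - (k - 1 - m.+1).+1%:Z by lia.
  have -> : m.+1%:Z - (k%:Z - 1) = - (k - 1 - m.+1)%N%:Z by lia.
  by rewrite !delta_powN /=; congr delta_inv; lia.
by rewrite TE delta_invE -casimir_nat// mulVKf// casimir_nat_neq0.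
Qed.

End EigenLadder.

(** * The invariant pairing *)

Section Pairing.
Context {R : realType}.
Local Notation C := (Rcomplex R).
Implicit Types (p q : {poly C}) (a b c z : C) (n m : nat).

Lemma pairingDl n p p' q : pairing n (p + p') q = pairing n p q + pairing n p' q.
Proof.
rewrite /pairing -big_split /=; apply: eq_bigr => i _; rewrite coefD; ring.
Qed.

Lemma pairingZl n c p q : pairing n (c *: p) q = c * pairing n p q.
Proof.
rewrite /pairing mulr_sumr; apply: eq_bigr => i _; rewrite coefZ; ring.
Qed.

Lemma pairingDr n p q q' : pairing n p (q + q') = pairing n p q + pairing n p q'.
Proof.
rewrite /pairing -big_split /=; apply: eq_bigr => i _; rewrite coefD; ring.
Qed.

Lemma pairingZr n c p q : pairing n p (c *: q) = c * pairing n p q.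
Proof.
rewrite /pairing mulr_sumr; apply: eq_bigr => i _; rewrite coefZ; ring.
Qed.

Lemma pairingNl n p q : pairing n (- p) q = - pairing n p q.
Proof. by rewrite -scaleN1r pairingZl mulN1r. Qed.

Lemma pairingNr n p q : pairing n p (- q) = - pairing n p q.
Proof. by rewrite -scaleN1r pairingZr mulN1r. Qed.

Lemma pairing0l n q : pairing n 0 q = 0.
Proof. by rewrite -(scale0r 0) pairingZl mul0r. Qed.

Lemma pairing_suml n (I : Type) (r : seq I) (P : pred I) (F : I -> {poly C}) q :
  pairing n (\sum_(i <- r | P i) F i) q = \sum_(i <- r | P i) pairing n (F i) q.
Proof.
apply: (big_morph (fun p => pairing n p q)) => [p p'|]; first exact: pairingDl.
exact: pairing0l.
Qed.

Lemma signr_even_sub n m : ~~ odd n -> (m <= n)%N -> (-1) ^+ (n - m) = (-1) ^+ m :> C.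
Proof. by move=> en mn; rewrite -signr_odd oddB// (negbTE en) addFb signr_odd. Qed.

Lemma pairing_sym n p q : ~~ odd n -> pairing n p q = pairing n q p.
Proof.
move=> en; rewrite /pairing (reindex_inj rev_ord_inj) /=; apply: eq_bigr => i _.
have i_n : (i <= n)%N by rewrite -ltnS.
by rewrite subSS subKn// bin_sub// signr_even_sub//; ring.
Qed.

(* The powers of linear forms represent the (homogeneous) evaluations. *)
Lemma pairing_linear_exp n c b q : ~~ odd n -> c != 0 -> (size q <= n.+1)%N ->
  pairing n ((c *: 'X - b%:P) ^+ n) q = c ^+ n * q.[b / c].
Proof.
move=> en c0 sq; rewrite (horner_coef_wide _ sq) mulr_sumr.
have cE i : ((c *: 'X - b%:P) ^+ n)`_i =
    if (i < n.+1)%N then (- b) ^+ (n - i) * c ^+ i *+ 'C(n, i) else 0.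
  have -> : (c *: 'X - b%:P) ^+ n =
      \poly_(i < n.+1) ((- b) ^+ (n - i) * c ^+ i *+ 'C(n, i)).
    rewrite addrC exprDn poly_def; apply: eq_bigr => j _.
    by rewrite exprZn -polyCN -polyC_exp mul_polyC scalerA -scalerMnl.
  by rewrite coef_poly.
rewrite /pairing (reindex_inj rev_ord_inj) /=; apply: eq_bigr => i _.
have i_n : (i <= n)%N by rewrite -ltnS.
rewrite cE subSS ltnS leq_subr subKn// bin_sub// signr_even_sub//.
have C0 : ('C(n, i)%:R : C) != 0 by rewrite natrC_eq0 -lt0n bin_gt0.
have -> : c ^+ n = c ^+ (n - i) * c ^+ i by rewrite -exprD subnK.
have -> : (- b) ^+ i = (-1) ^+ i * b ^+ i by rewrite -exprMn mulN1r.
rewrite -mulr_natr exprMn exprVn.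
transitivity (((-1) ^+ i * (-1) ^+ i) * (b ^+ i * c ^+ (n - i) * q`_i)); first by field.
rewrite -expr2 sqrr_sign mul1r; have ci := expf_neq0 i c0.
by field.
Qed.

Lemma natr_roots_eq0 (p : {poly C}) : (forall i : nat, p.[i%:R] = 0) -> p = 0.
Proof.
move=> h; apply: (@roots_geq_poly_eq0 _ p [seq i%:R | i <- iota 0 (size p)]).
- by apply/allP => x /mapP[i _ ->]; rewrite /root h.
- rewrite map_inj_uniq ?iota_uniq// => i j /eqP ij; apply/eqP.
  case: (leqP i j) ij => [lij|/ltnW lij] ij.
    by rewrite eqn_leq lij -subn_eq0 -(@natrC_eq0 R) natrB// subr_eq0 eq_sym.
  by rewrite eqn_leq lij andbT -subn_eq0 -(@natrC_eq0 R) natrB// subr_eq0.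
- by rewrite size_map size_iota.
Qed.

Lemma linear_combE a b c :
  ('X - a%:P) + c *: ('X - b%:P) = (1 + c) *: 'X - (a + c * b)%:P :> {poly C}.
Proof. rewrite -!mul_polyC !polyCD polyCM; ring. Qed.

Lemma pairing_linear_comb n a b c q : ~~ odd n -> 1 + c != 0 -> (size q <= n.+1)%N ->
  \sum_(j < n.+1) c ^+ j * ('C(n, j)%:R * pairing n (('X - a%:P) ^+ (n - j) * ('X - b%:P) ^+ j) q)
  = (1 + c) ^+ n * q.[(a + c * b) / (1 + c)].
Proof.
move=> en c0 sq; rewrite -pairing_linear_exp// -linear_combE exprDn pairing_suml.
apply: eq_bigr => j _; rewrite exprZn -scalerAr scalerMnl pairingZl -mulr_natr; ring.
Qed.

Lemma pairing_XsubC n a b j m : ~~ odd n -> (j <= n)%N -> (m <= n)%N ->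
  'C(n, j)%:R * pairing n (('X - a%:P) ^+ (n - j) * ('X - b%:P) ^+ j)
                          (('X - a%:P) ^+ m * ('X - b%:P) ^+ (n - m)) =
  ((b - a) ^+ m * (a - b) ^+ (n - m)) *+ (j == m).
Proof.
move=> en jn mn; set q := _ ^+ m * _.
have sq : (size q <= n.+1)%N.
  apply: (leq_trans (size_polyMleq _ _)); rewrite !size_exp_XsubC; lia.
pose p := \poly_(j < n.+1) ('C(n, j)%:R *
  pairing n (('X - a%:P) ^+ (n - j) * ('X - b%:P) ^+ j) q).
have : p - ((b - a) ^+ m * (a - b) ^+ (n - m)) *: 'X^m = 0.
  apply: natr_roots_eq0 => t.
  have t0 : 1 + t%:R != 0 :> C by rewrite nat1r natrC_eq0.
  rewrite hornerD hornerN hornerZ hornerXn; apply/eqP; rewrite subr_eq0; apply/eqP.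
  rewrite (horner_coef_wide _ (size_poly _ _)).
  transitivity ((1 + t%:R) ^+ n * q.[(a + t%:R * b) / (1 + t%:R)] : C).
    rewrite -pairing_linear_comb//; apply: eq_bigr => i _.
    by rewrite coef_poly ltn_ord mulrC.
  rewrite hornerM !horner_exp !hornerXsubC.
  have -> : (1 + t%:R) ^+ n = (1 + t%:R) ^+ m * (1 + t%:R) ^+ (n - m) :> C.
    by rewrite -exprD subnKC.
  rewrite mulrACA -!exprMn.
  have -> : (1 + t%:R) * ((a + t%:R * b) / (1 + t%:R) - a) = t%:R * (b - a) by field.
  have -> : (1 + t%:R) * ((a + t%:R * b) / (1 + t%:R) - b) = a - b by field.
  rewrite exprMn; ring.
move=> /(congr1 (fun p : {poly C} => p`_j)).
rewrite coef0 coefB coef_poly ltnS jn coefZ coefXn => /eqP.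
by rewrite subr_eq0 => /eqP ->; rewrite mulr_natr.
Qed.

Lemma pairing_nondegenerate n a b p : ~~ odd n -> a != b -> (size p <= n.+1)%N ->
  (forall m, (m <= n)%N -> pairing n p (('X - a%:P) ^+ (n - m) * ('X - b%:P) ^+ m) = 0) ->
  p = 0.
Proof.
move=> en ab sp h.
pose r (t : nat) : C := (a + t%:R * b) / (1 + t%:R).
have t0 (t : nat) : 1 + t%:R != 0 :> C by rewrite nat1r natrC_eq0.
have pr t : p.[r t] = 0.
  apply: (mulfI (expf_neq0 n (t0 t))); rewrite -pairing_linear_comb// mulr0 big1// => j _.
  by rewrite pairing_sym// h ?mulr0// -ltnS.
have r_inj : injective r.
  move=> s t rst; have : (a - b) * (t%:R - s%:R) = 0.
    have := rst; rewrite /r => /eqP; rewrite eqr_div// => /eqP e.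
    transitivity ((a + s%:R * b) * (1 + t%:R) - (a + t%:R * b) * (1 + s%:R)); first by ring.
    by rewrite e subrr.
  move=> /eqP; rewrite mulf_eq0 !subr_eq0 (negbTE ab) /= => ts.
  apply/eqP; case: (leqP s t) ts => [l|/ltnW l] ts.
    by rewrite eqn_leq l -subn_eq0 -(@natrC_eq0 R) natrB// subr_eq0.
  by rewrite eqn_leq l andbT -subn_eq0 -(@natrC_eq0 R) natrB// subr_eq0 eq_sym.
apply: (@roots_geq_poly_eq0 _ p [seq r t | t <- iota 0 n.+1]).
- by apply/allP => x /mapP[t _ ->]; rewrite /root pr.
- by rewrite map_inj_uniq ?iota_uniq.
- by rewrite size_map size_iota.
Qed.

Lemma zbasisE n m z : zbasis n m z =
  ((m`!)%:R^-1 * yinv z ^+ (n - m)) *: (('X - z%:P) ^+ m * ('X - (cconj z)%:P) ^+ (n - m)).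
Proof.
by rewrite /zbasis exprZn -scalerAl -scalerAr scalerA.
Qed.

Lemma pairing_zbasis n m m' z : ~~ odd n -> complex.Im z != 0 ->
  (m <= n)%N -> (m' <= n)%N ->
  pairing n (zbasis n m z) (zbasis n (n - m') z) = ((-1) ^+ m / n`!%:R) *+ (m == m').
Proof.
move=> en z0 mn mn'; have y0 := yinv_neq0 z0.
have := pairing_XsubC z (cconj z) en (leq_subr m n) (leq_subr m' n).
rewrite !zbasisE pairingZl pairingZr (subKn mn) (subKn mn').
have -> : ((n - m)%N == (n - m')%N) = (m == m') by apply/eqP/eqP; lia.
have C0 : ('C(n, n - m)%:R : C) != 0 by rewrite natrC_eq0 -lt0n bin_gt0 leq_subr.
set P := pairing _ _ _ => /(congr1 (fun x => 'C(n, n - m)%:R^-1 * x)).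
rewrite mulKf// => ->; case: eqP => [<-|_]; last by rewrite !mulr0n !mulr0.
rewrite !mulr1n.
have -> : (cconj z - z) ^+ (n - m) = (-1) ^+ m * (z - cconj z) ^+ (n - m).
  by rewrite -opprB [LHS]exprNn signr_even_sub.
rewrite (subconjV z).
have fE : 'C(n, n - m)%:R * (m`!%:R * (n - m)`!%:R) = n`!%:R :> C.
  by rewrite bin_sub// -!natrM bin_fact.
rewrite -fE !invfM !exprVn.
have f0 i : (i`!%:R : C) != 0 by rewrite natrC_eq0 -lt0n fact_gt0.
have d0 : z - cconj z != 0 by rewrite (subconjV z) invr_neq0.
by field; rewrite !f0 C0 !expf_neq0.
Qed.

Lemma Q_exp (N : nat) z : Q z ^+ N = N`!%:R *: zbasis (2 * N) N z.
Proof.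
have f0 : (N`!%:R : C) != 0 by rewrite natrC_eq0 -lt0n fact_gt0.
rewrite zbasisE scalerA mulrA mulfV// mul1r /Q -/(yinv z).
have -> : (2 * N - N = N)%N by lia.
by rewrite exprZn exprMn.
Qed.

Lemma wirt_pairing n (G H : C -> {poly C}) z (A B A' B' : {poly C}) :
  wirtp G z A B -> wirtp H z A' B' ->
  wirt (fun u => pairing n (G u) (H u)) z
    (pairing n A (H z) + pairing n (G z) A') (pairing n B (H z) + pairing n (G z) B').
Proof.
move=> h h'; rewrite /pairing -!big_split /=.
pose F i u : C := (-1) ^+ i * (G u)`_i * (H u)`_(n - i) / 'C(n, i)%:R.
have hF (i : 'I_n.+1) : wirt (fun u => F i u) z
   ((-1) ^+ i * A`_i * (H z)`_(n - i) / 'C(n, i)%:R +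
    (-1) ^+ i * (G z)`_i * A'`_(n - i) / 'C(n, i)%:R)
   ((-1) ^+ i * B`_i * (H z)`_(n - i) / 'C(n, i)%:R +
    (-1) ^+ i * (G z)`_i * B'`_(n - i) / 'C(n, i)%:R).
  have w := wirtZ ((-1) ^+ i / 'C(n, i)%:R) (wirtM (h i) (h' (n - i)%N)).
  have -> : F i = fun u => (-1) ^+ i / 'C(n, i)%:R * ((G u)`_i * (H u)`_(n - i)).
    by apply/funext => u; rewrite /F; ring.
  by apply: (wirt_eq w); ring.
exact: (@wirt_sum _ _ _ _ (fun (i : 'I_n.+1) u => F i u) (fun i _ => _) (fun i _ => _) z
  (fun i _ => hF i)).
Qed.

Lemma smooth_pairing (U : set C) n (G H : C -> {poly C}) : open U ->
  smoothp U G -> smoothp U H -> smooth_on U (fun u => pairing n (G u) (H u)).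
Proof.
move=> oU sG sH; apply: (smooth_sum oU) => i _.
apply: (smoothM oU); last exact: smooth_cst.
apply: (smoothM oU) => //; apply: (smoothM oU) => //; exact: smooth_cst.
Qed.

End Pairing.

(** * The theorem *)

Section Tilde.
Context {R : realType}.
Local Notation C := (Rcomplex R).
Implicit Types (z : C) (m : nat).
Variable S : set C.
Hypothesis hS : discrete_in_half_plane S.
Variable k : nat.
Hypothesis k1 : (1 <= k)%N.
Let n := (2 * k - 2)%N.
Let N := (k - 1)%N.
Let U := domain S.

Let oU : open U := domain_open hS.
Let UIm z : U z -> complex.Im z != 0 := @domain_Im R S z.

Let nE : n = (2 * N)%N. Proof. rewrite /n /N; lia. Qed.
Let n_even : ~~ odd n. Proof. by rewrite nE oddM. Qed.

Let fact_neq0 i : (i`!%:R : C) != 0.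
Proof. by rewrite natrC_eq0 -lt0n fact_gt0. Qed.

(* [Qladder m] is delta^(m - N) Q^N. *)
Definition Qladder m z : {poly C} :=
  ((-1) ^+ (m + N) * N`!%:R) *: zbasis n (n - m) z.

Lemma QladderN z : Qladder N z = Q z ^+ N.
Proof.
rewrite Q_exp -nE /Qladder addnn -mul2n exprM sqrrN !expr1n mul1r.
by congr (_ *: zbasis _ _ _); rewrite nE; lia.
Qed.

Lemma pairing_XsubC_exp z (q : {poly C}) : (size q <= n.+1)%N ->
  pairing n (('X - z%:P) ^+ n) q = q.[z].
Proof.
move=> sq; have := pairing_linear_exp z n_even (oner_neq0 C) sq.
by rewrite scale1r expr1n mul1r divr1.
Qed.

Lemma ladder_pairing (g : C -> {poly C}) (a b : C -> C) :
  smoothp U g ->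
  (forall z, U z -> wirtp g z (a z *: ('X - z%:P) ^+ n) (b z *: ('X - (cconj z)%:P) ^+ n)) ->
  ladder U n (fun m z => pairing n (g z) (Qladder m z)).
Proof.
move=> sg wg.
have hE (m : nat) : (fun z => pairing n (g z) (Qladder m z)) =
    fun z => ((-1) ^+ (m + N) * N`!%:R) * pairing n (g z) (zbasis n (n - m) z).
  by apply/funext => z; rewrite pairingZr.
have w m z (Uz : U z) := wirtZ ((-1) ^+ (m + N) * N`!%:R)
  (wirt_pairing n (wg z Uz) (wirtp_zbasis (UIm Uz) (leq_subr m n))).
split=> [m mn|m z mn Uz|m z mn Uz].
- apply: (@smooth_pairing _ U n g (Qladder m) oU) => //.
  apply: (smoothpZ oU); first exact: smooth_cst.
  exact: smoothp_zbasis.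
- rewrite hE deltaE (wirt_dz (w m z Uz)) pairingZl (pairing_XsubC_exp z (size_zbasis z (leq_subr m n))).
  have -> : (zbasis n (n - m) z).[z] = 0.
    by rewrite zbasisE !(hornerZ, hornerM, horner_exp, hornerXsubC) subrr expr0n subn_eq0 leqNgt mn /= mul0r mulr0.
  have -> : (0 < n - m)%N by rewrite subn_gt0.
  rewrite mulr1n /Qladder pairingDr pairingNr !pairingZr -subnS addSn exprS.
  rewrite natrB; last exact: ltnW.
  rewrite intrB intrM -!pmulrn; ring.
- rewrite /delta_minus (subconjV z).
  rewrite hE (wirt_dzbar (w m.+1 z Uz)) pairingZl
    (pairing_XsubC_exp (cconj z) (size_zbasis z (leq_subr m.+1 n))).
  have -> : (zbasis n (n - m.+1) z).[cconj z] = 0.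
    rewrite zbasisE !(hornerZ, hornerM, horner_exp, hornerXsubC) subKn// subrr.
    by rewrite expr0n !mulr0.
  rewrite subKn// subnSK// /Qladder !pairingZr addSn [(-1) ^+ _.+1]exprS.
  have y0 := yinv_neq0 (UIm Uz).
  set y := yinv z in y0 *.
  by field.
Qed.

Lemma coef_pairing i (q : {poly C}) : (i <= n)%N ->
  pairing n (((-1) ^+ (n - i) * 'C(n, i)%:R) *: 'X^(n - i)) q = q`_i.
Proof.
move=> i_n; have j0 : (n - i < n.+1)%N by rewrite ltnS leq_subr.
have C0 : ('C(n, i)%:R : C) != 0 by rewrite natrC_eq0 -lt0n bin_gt0.
rewrite /pairing (bigD1 (Ordinal j0)) //= big1 ?addr0.
  rewrite coefZ coefXn eqxx mulr1 mulrA -expr2 sqrr_sign mul1r subKn// bin_sub//.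
  by field.
move=> j /negP jn; rewrite coefZ coefXn; case: eqP => [e|_].
  by case: jn; apply/eqP/val_inj.
by rewrite !mulr0 !mul0r.
Qed.

Lemma coefwise_Q m z : (m <= n)%N -> U z ->
  coefwise n (delta_pow k%:Z 0 (m%:Z - (k%:Z - 1))) (fun u => Q u ^+ N) z = Qladder m z.
Proof.
move=> mn Uz; apply/polyP => i; rewrite coef_poly; case: ltnP => [i_n|ni]; last first.
  rewrite nth_default// (leq_trans _ ni)// (leq_trans (size_scale_leq _ _))//.
  by rewrite size_zbasis ?leq_subr.
rewrite ltnS in i_n.
pose c : {poly C} := ((-1) ^+ (n - i) * 'C(n, i)%:R) *: 'X^(n - i).
have L : ladder U n (fun m z => pairing n c (Qladder m z)).
  apply: (@ladder_pairing (fun=> c) (fun=> 0) (fun=> 0)); first exact: smoothp_cst.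
  by move=> u _; rewrite !scale0r; exact: wirtp_cst.
have -> : (fun u => (Q u ^+ N)`_i) = fun u => pairing n c (Qladder N u).
  by apply/funext => u; rewrite QladderN coef_pairing.
by rewrite (ladder_pow oU k1 L mn Uz) coef_pairing.
Qed.

Section Forward.
Variable f : C -> C.
Hypothesis Ff : F k%:Z 0 S f.

Let T m := delta_pow k%:Z 0 (m%:Z - (k%:Z - 1)) f.
Let c0 : C := (-1) ^+ N * n`!%:R / N`!%:R.

Let LT : ladder U n T := F_ladder hS k1 Ff.

Lemma tildeE z : tilde k f z = c0 *: \sum_(m < n.+1) T m z *: zbasis n m z.
Proof. by []. Qed.

Lemma pairing_tilde m z : (m <= n)%N -> U z ->
  pairing n (tilde k f z) (Qladder m z) = T m z.
Proof.
move=> mn Uz; rewrite tildeE pairingZl pairing_suml.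
rewrite (bigD1 (Ordinal (mn : (m < n.+1)%N))) //= big1 ?addr0; last first.
  move=> j /negP jm; have jn : (j <= n)%N by rewrite -ltnS.
  rewrite pairingZl /Qladder pairingZr (pairing_zbasis n_even (UIm Uz) jn mn).
  case: eqP => [e|_]; first by case: jm; apply/eqP/val_inj.
  by rewrite mulr0n !mulr0.
rewrite pairingZl /Qladder pairingZr (pairing_zbasis n_even (UIm Uz) mn mn) eqxx mulr1n.
have s i : (-1) ^+ i * (-1) ^+ i = 1 :> C by rewrite -expr2 sqrr_sign.
rewrite exprD /c0.
move: (n`!%:R : C) (N`!%:R : C) (fact_neq0 n) (fact_neq0 N) => p q p0 q0.
transitivity (((-1) ^+ N * (-1) ^+ N) * ((-1) ^+ m * (-1) ^+ m) * T m z); first by field; rewrite p0 q0.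
by rewrite !s !mul1r.
Qed.

Lemma wirtp_tilde z : U z ->
  wirtp (tilde k f) z
    ((c0 / n`!%:R * delta n%:Z (T n) z) *: ('X - z%:P) ^+ n)
    ((c0 * dzbar (T 0%N) z * yinv z ^+ n) *: ('X - (cconj z)%:P) ^+ n).
Proof.
move=> Uz; have h := wirtpZ (wirt_cst z c0) (ladder_sum UIm LT Uz).
apply: (wirtp_eq h); rewrite scale0r add0r zbasisE !scalerA.
  by rewrite subnn !expr0 !mulr1; congr (_ *: _); ring.
by rewrite subn0 expr0 mul1r fact0 invr1 mul1r.
Qed.

Lemma size_tilde z : (size (tilde k f z) <= n.+1)%N.
Proof.
rewrite tildeE; apply: (leq_trans (size_scale_leq _ _)).
apply: (leq_trans (size_sum _ _ _)); apply/bigmax_leqP => m _.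
by apply: (leq_trans (size_scale_leq _ _)); rewrite size_zbasis// -ltnS.
Qed.

Lemma smoothp_tilde : smoothp U (tilde k f).
Proof.
apply: (smoothpZ oU); first exact: smooth_cst.
apply: (smoothp_sum oU) => m _; apply: (smoothpZ oU); last exact: smoothp_zbasis.
by case: LT => sT _ _; apply: sT; rewrite -ltnS.
Qed.

Lemma dz_dzbar_T0 z : U z -> dz (dzbar (T 0%N)) z = n%:R * yinv z * dzbar (T 0%N) z.
Proof.
move=> Uz; have [_ /(_ z Uz)] := F_delta_inv_iter hS k1 Ff (leqnn N).
have -> : delta_inv_iter k%:Z 0 N f = T 0%N.
  rewrite /T; have -> : 0%:Z - (k%:Z - 1) = - N%:Z by rewrite /N; lia.
  by rewrite delta_powN.
have -> : ((k%:Z * (1 - k%:Z))%:~R + (- (2 * N%:Z) * (- (2 * N%:Z) - 2))%:~R / 4 : C) = 0.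
  have h4 : (4 : C) != 0 by rewrite natrC_eq0.
  have -> : - (2 * N%:Z) * (- (2 * N%:Z) - 2) = - (4 * (k%:Z * (1 - k%:Z))).
    by rewrite /N; nia.
  by rewrite intrN [(4 * _)%:~R]intrM; field.
rewrite mul0r /Laplace (subconjV z) => e.
have y0 := yinv_neq0 (UIm Uz); have yy0 := expf_neq0 2 (invr_neq0 y0).
apply: (mulfI yy0); move/eqP: e; rewrite addr_eq0 => /eqP ->.
rewrite nE natrM intrN intrM -!pmulrn.
set y := yinv z in y0 *.
by field.
Qed.

Lemma F_tensor_V_tilde : F_tensor_V 0 0 n S (tilde k f).
Proof.
split=> [z _|i i_n]; first exact: size_tilde.
split=> [|z Uz]; first exact: smoothp_tilde.
have E u : U u -> dzbar (fun z => (tilde k f z)`_i) u =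
    c0 * dzbar (T 0%N) u * (zbasis n 0 u)`_i.
  move=> Uu; rewrite (wirt_dzbar (wirtp_tilde Uu i)) zbasisE !coefZ.
  by rewrite subn0 expr0 fact0 invr1 !mul1r; exact: esym (mulrA _ _ _).
rewrite /Laplace (dz_open oU Uz E).
have sT : smooth_on U (T 0%N) by case: LT => sT _ _; exact: sT.
have w := wirtM (wirtZ c0 (smooth_wirt (smooth_dzbar oU sT) Uz))
  (wirtp_zbasis (UIm Uz) (leq0n n) i).
rewrite (wirt_dz w) /= dz_dzbar_T0// mulr0n oppr0 add0r coefZ.
rewrite !mul0r mul0rn; ring.
Qed.

Lemma delta_powk z : delta n%:Z (T n) z = delta_pow k%:Z 0 k%:Z f z.
Proof.
have kE : k = N.+1 by rewrite /N; lia.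
rewrite /T; have -> : n%:Z - (k%:Z - 1) = N%:Z by rewrite /n /N; lia.
rewrite [in RHS]kE /=; congr (delta _ _ _).
by rewrite nE; lia.
Qed.

Lemma smooth_delta_iter w p (h : C -> C) : smooth_on U h -> smooth_on U (delta_iter w p h).
Proof. by move=> sh; elim: p => [|p IH] //=; exact: (smooth_delta oU UIm). Qed.

Lemma cconjK z : cconj (cconj z) = z.
Proof. by case: z => a b; rewrite /cconj /= opprK. Qed.

Lemma cconj_yinv z : cconj (yinv z) = - yinv z.
Proof.
rewrite /yinv; have -> : cconj (z - cconj z)^-1 = (cconj (z - cconj z))^-1 :> C.
  exact: (fmorphV (@conjc R)).
have -> : cconj (z - cconj z) = - (z - cconj z) :> C.
  transitivity (cconj z - cconj (cconj z)); first exact: (rmorphB (@conjc R)).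
  by rewrite cconjK opprB.
by rewrite invrN.
Qed.

Lemma deltabarS p (h : C -> C) c z : smooth_on U h ->
  (forall u, U u -> deltabar_iter 0 p f u = c * yinv u ^+ (2 * p) * h u) -> U z ->
  deltabar_iter 0 p.+1 f z = c * yinv z ^+ (2 * p) * dzbar h z.
Proof.
move=> sh hp Uz; pose D := delta_iter 0 p (fun u => cconj (f u)).
have sD : smooth_on U D.
  by apply: smooth_delta_iter; apply: (smooth_conj oU); case: Ff.
have cM u v : cconj (u * v) = cconj u * cconj v :> C by exact: (rmorphM (@conjc R)).
have cD u v : cconj (u + v) = cconj u + cconj v :> C by exact: (rmorphD (@conjc R)).
have ci (i : int) : cconj i%:~R = i%:~R :> C by exact: (rmorph_int (@conjc R)).
transitivity (cconj (dz D z) + (0 + 2 * p%:Z)%:~R * - yinv z * deltabar_iter 0 p f z).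
  rewrite [LHS]/deltabar_iter [delta_iter _ _ _]/= -/D deltaE cD; congr (_ + _).
  by rewrite !cM ci cconj_yinv.
have -> : cconj (dz D z) = dzbar (deltabar_iter 0 p f) z.
  by rewrite (wirt_dzbar (wirt_conj (smooth_wirt sD Uz))).
rewrite (dzbar_open oU Uz hp) hp//.
have w := wirtM (wirtZ c (wirt_exp (2 * p) (wirt_yinv (UIm Uz)))) (smooth_wirt sh Uz).
rewrite (wirt_dzbar w) add0r intrM -!pmulrn.
case: p {hp D sD w} => [|p]; first by rewrite muln0 mulr0n; ring.
rewrite natrM mulnS addSn /= !exprS; ring.
Qed.

Lemma deltabar_iterE p z : (p <= N)%N -> U z ->
  deltabar_iter 0 p f z =
    ((-1) ^+ p * (N + p)`!%:R / (N - p)`!%:R) * yinv z ^+ (2 * p) * T (N - p)%N z.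
Proof.
case: LT => sT _ Tzb.
elim: p z => [|p IH] z pN Uz.
  rewrite muln0 addn0 subn0 !expr0 mul1r mulfV ?fact_neq0// !mul1r /deltabar_iter /=.
  rewrite cconjK /T; have -> : N%:Z - (k%:Z - 1) = 0 by rewrite /N; lia.
  by [].
have sTp : smooth_on U (T (N - p)%N) by apply: sT; rewrite nE; lia.
rewrite (deltabarS sTp (fun u Uu => IH u (ltnW pN) Uu) Uz).
have pn : (N - p.+1 < n)%N by rewrite nE; lia.
have := Tzb (N - p.+1)%N z pn Uz; rewrite subnSK// /delta_minus (subconjV z).
have -> : (n - (N - p.+1))%N = (N + p).+1 by rewrite nE; lia.
have y0 := yinv_neq0 (UIm Uz); move=> e.
have -> : dzbar (T (N - p)%N) z = yinv z ^+ 2 * - (((N - p) * (N + p).+1)%:R * T (N - p.+1)%N z).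
  apply: (mulfI (expf_neq0 2 (invr_neq0 y0))); rewrite e; set y := yinv z in y0 *.
  by field.
have fE : ((N - p)`!%:R : C) = (N - p)%:R * (N - p.+1)`!%:R.
  by rewrite -(subnSK pN) factS natrM.
have f1 := fact_neq0 (N - p.+1)%N.
have f2 : ((N - p)%:R : C) != 0 by rewrite natrC_eq0; lia.
have e2 : yinv z ^+ (2 * p.+1) = yinv z ^+ 2 * yinv z ^+ (2 * p) by rewrite -exprD -mulnS.
rewrite fE addnS factS e2 !natrM [(-1) ^+ p.+1]exprS.
set y := yinv z in y0 *.
by field; rewrite f1 f2.
Qed.

Lemma deltabar_k z : U z ->
  c0 * dzbar (T 0%N) z * yinv z ^+ n = deltabar_iter 0 k f z / N`!%:R.
Proof.
case: LT => sT _ _ Uz; have kE : k = N.+1 by rewrite /N; lia.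
have sTN : smooth_on U (T (N - N)%N) by apply: sT; rewrite nE; lia.
rewrite [in RHS]kE (deltabarS sTN (fun u Uu => deltabar_iterE (leqnn N) Uu) Uz).
rewrite subnn fact0 divr1 addnn -mul2n -nE /c0; ring.
Qed.

End Forward.

Lemma dvdp_XsubC_exp a (p : {poly C}) : (size p <= n.+1)%N ->
  ('X - a%:P) ^+ n %| p -> exists c, p = c *: ('X - a%:P) ^+ n.
Proof.
move=> sp /dvdpP[q pE]; have [->|q0] := eqVneq p 0; first by exists 0; rewrite scale0r.
suff /size1_polyC qE : (size q <= 1)%N by exists q`_0; rewrite pE {1}qE mul_polyC.
have q_neq0 : q != 0 by apply: contra_neq q0 => q0; rewrite pE q0 mul0r.
have mX : ('X - a%:P) ^+ n \is monic by rewrite monic_exp ?monicXsubC.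
by move: sp; rewrite pE size_Mmonic// size_exp_XsubC addnS /= -add1n leq_add2r.
Qed.

Section Backward.
Variable g : C -> {poly C}.
Hypothesis Fg : F_tensor_V 0 0 n S g.
Hypothesis gz : forall z, U z -> ('X - z%:P) ^+ n %| coefwise n (@dz R) g z.
Hypothesis gzb : forall z, U z -> ('X - (cconj z)%:P) ^+ n %| coefwise n (@dzbar R) g z.

Let f z := pairing n (g z) (Q z ^+ N).

Lemma smoothp_g : smoothp U g.
Proof.
move=> i; case: Fg => sg Fg'; have [i_n|n_i] := leqP i n; first by case: (Fg' i i_n).
apply: (@smooth_eq _ _ oU (fun=> 0)); last exact: smooth_cst.
by move=> u Uu; rewrite nth_default// (leq_trans (sg u Uu)).
Qed.

Lemma wirtp_g z : U z -> wirtp g z (coefwise n (@dz R) g z) (coefwise n (@dzbar R) g z).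
Proof.
move=> Uz i; rewrite !coef_poly ltnS; have [i_n|n_i] := leqP i n.
  exact: smooth_wirt (smoothp_g i) Uz.
apply: (@wirt_open _ U (fun=> 0)) => //; last exact: wirt_cst.
by move=> u Uu; rewrite nth_default// (leq_trans (Fg.1 u Uu)).
Qed.

Lemma ladder_g : ladder U n (fun m z => pairing n (g z) (Qladder m z)).
Proof.
have ea z : exists a, U z -> coefwise n (@dz R) g z = a *: ('X - z%:P) ^+ n.
  have [Uz|nU] := pselect (U z); last by exists 0.
  by have [a aE] := dvdp_XsubC_exp (size_poly _ _) (gz Uz); exists a.
have eb z : exists b, U z -> coefwise n (@dzbar R) g z = b *: ('X - (cconj z)%:P) ^+ n.
  have [Uz|nU] := pselect (U z); last by exists 0.
  by have [a aE] := dvdp_XsubC_exp (size_poly _ _) (gzb Uz); exists a.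
have [a aE] := choice ea; have [b bE] := choice eb.
apply: (@ladder_pairing g a b); first exact: smoothp_g.
by move=> z Uz; rewrite -aE// -bE//; exact: wirtp_g.
Qed.

Let fE : f = fun z => pairing n (g z) (Qladder N z).
Proof. by apply/funext => z; rewrite QladderN. Qed.

Lemma F_pairing : F k%:Z 0 S f.
Proof.
have [sL Lz Lzb] := ladder_g; have sf : smooth_on U f by rewrite fE; apply: sL; rewrite nE; lia.
split=> // z Uz; have [N0|N0] := eqVneq N 0%N.
  have k_1 : k = 1%N by move: N0; rewrite /N; lia.
  have n0 : n = 0%N by rewrite nE N0.
  have [_ /(_ z Uz)] := Fg.2 0%N (leq0n n).
  have -> : f = fun u => (g u)`_0.
    apply/funext => u; rewrite /f N0 n0 /pairing big_ord1 expr0 mul1r coef1 eqxx.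
    by rewrite mulr1 bin0 divr1.
  by move=> ->; rewrite k_1.
have N1 : N = N.-1.+1 by rewrite prednK// lt0n.
have mn : (N.-1 < n)%N by rewrite nE; lia.
rewrite -[0 in LHS](_ : -2 + 2 = 0)// -(delta_delta_minus oU UIm (-2) sf Uz).
have E u : U u -> delta_minus f u =
    - (N * k)%:R * pairing n (g u) (Qladder N.-1 u).
  move=> Uu; rewrite fE [in LHS]N1 Lzb//; congr (- _%:R * _).
  by rewrite -N1 nE /N; nia.
rewrite (eq_delta oU _ Uz E) (deltaZ _ _ (sL _ (ltnW mn)) Uz).
have -> : -2 = 2 * N.-1%:Z - n%:Z by rewrite nE; lia.
rewrite Lz// -N1 -/(f z) fE.
have -> : k%:Z * (1 - k%:Z) = - (N * k)%N%:Z by rewrite /N; nia.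
by rewrite !mul0r addr0 intrN.
Qed.

Lemma g_tilde z : U z -> g z = tilde k f z.
Proof.
move=> Uz; apply/eqP; rewrite -subr_eq0; apply/eqP.
have zz : z != cconj z.
  rewrite -subr_eq0 (subconjV z) invr_eq0; exact: yinv_neq0 (UIm Uz).
apply: (pairing_nondegenerate n_even zz).
  rewrite (leq_trans (size_polyD _ _))// geq_max size_polyN size_tilde andbT.
  exact: Fg.1.
move=> m mn.
have : pairing n (g z - tilde k f z) (Qladder m z) = 0.
  rewrite pairingDl pairingNl (pairing_tilde f mn Uz).
  rewrite fE (ladder_pow oU k1 ladder_g mn Uz); ring.
rewrite /Qladder pairingZr zbasisE pairingZr subKn// => /eqP.
have c1 : (-1) ^+ (m + N) * N`!%:R != 0 :> C.
  by apply: mulf_neq0; [rewrite signr_eq0|exact: fact_neq0].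
have c2 : (n - m)`!%:R^-1 * yinv z ^+ m != 0.
  by apply: mulf_neq0; [rewrite invr_neq0|rewrite expf_neq0// yinv_neq0// UIm].
by rewrite mulf_eq0 (negbTE c1) mulf_eq0 (negbTE c2) => /eqP.
Qed.

End Backward.
End Tilde.

Theorem theorem1p2p5 (R : realType) (k : nat) (hk : (1 <= k)%N)
    (S : set (Rcomplex R)) (hS : discrete_in_half_plane S) :
  (forall f : Rcomplex R -> Rcomplex R, F k%:Z 0 S f ->
    [/\ F_tensor_V 0 0 (2 * k - 2) S (tilde k f),
        forall z, domain S z ->
          f z = pairing (2 * k - 2) (tilde k f z) (Q z ^+ (k - 1)),
        forall l : int, 1 - k%:Z <= l <= k%:Z - 1 ->
          forall z, domain S z ->
            delta_pow k%:Z 0 l f z =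
            pairing (2 * k - 2) (tilde k f z)
              (coefwise (2 * k - 2) (delta_pow k%:Z 0 l)
                 (fun u => Q u ^+ (k - 1)) z),
        forall z, domain S z ->
          coefwise (2 * k - 2) (@dz R) (tilde k f) z =
          ((-1) ^+ (k - 1) * delta_pow k%:Z 0 k%:Z f z / ((k - 1)`!)%:R) *:
            ('X - z%:P) ^+ (2 * k - 2)
      & forall z, domain S z ->
          coefwise (2 * k - 2) (@dzbar R) (tilde k f) z =
          (deltabar_iter 0 k f z / ((k - 1)`!)%:R) *:
            ('X - (cconj z)%:P) ^+ (2 * k - 2)])
  /\
  (forall g : Rcomplex R -> {poly Rcomplex R},
    F_tensor_V 0 0 (2 * k - 2) S g ->
    (forall z, domain S z ->
       ('X - z%:P) ^+ (2 * k - 2) %| coefwise (2 * k - 2) (@dz R) g z) ->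
    (forall z, domain S z ->
       ('X - (cconj z)%:P) ^+ (2 * k - 2)
         %| coefwise (2 * k - 2) (@dzbar R) g z) ->
    let f := fun z => pairing (2 * k - 2) (g z) (Q z ^+ (k - 1)) in
    F k%:Z 0 S f /\ forall z, domain S z -> g z = tilde k f z).
Proof.
split=> [f Ff|g Fg gz gzb].
  have f0 i : (i`!%:R : Rcomplex R) != 0 by rewrite natrC_eq0 -lt0n fact_gt0.
  split.
  - exact: F_tensor_V_tilde.
  - move=> z Uz; have kn : (k - 1 <= 2 * k - 2)%N by lia.
    rewrite -(QladderN hk) (pairing_tilde hk f kn Uz).
    by have -> : (k - 1)%N%:Z - (k%:Z - 1) = 0 by lia.
  - move=> l /andP[l1 l2] z Uz.
    have [m lE] : exists m : nat, l = m%:Z - (k%:Z - 1).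
      by exists (absz (l + (k%:Z - 1))); lia.
    have mn : (m <= 2 * k - 2)%N by lia.
    by rewrite lE (coefwise_Q hS hk mn Uz) (pairing_tilde hk f mn Uz).
  - move=> z Uz; rewrite (coefwise_dz (wirtp_tilde hS hk Ff Uz)).
      rewrite delta_powk//; congr (_ *: _).
      by field; rewrite !f0.
    by apply: (leq_trans (size_scale_leq _ _)); rewrite size_exp_XsubC.
  - move=> z Uz; rewrite (coefwise_dzbar (wirtp_tilde hS hk Ff Uz)).
      by rewrite (deltabar_k hS hk Ff Uz).
    by apply: (leq_trans (size_scale_leq _ _)); rewrite size_exp_XsubC.
split; first exact: F_pairing.
exact: g_tilde.
Qed.
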